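(* Let $T>0$ and let $\gamma\in\mathcal{C}^1_T(\mathbb{R})$. Then the functionals $\underline{\mu}[\gamma]:\mathcal{C}^1_T(\mathbb{R})\to\mathbb{R}$ and $\overline{\mu}[\gamma]:\mathcal{C}^1_{T,0}(\mathbb{R})\to\mathbb{R}$ are continuous and satisfy $$\underline{\mu}[\gamma](p)\le \overline{\mu}[\gamma](q)\le 0\qquad\text{for any } p\in\mathcal{C}^1_T(\mathbb{R})\text{ and } q\in\mathcal{C}^1_{T,0}(\mathbb{R}).$$ Moreover, there exists $p^*\in\mathcal{C}^1_{T,0}(\mathbb{R})$ such that $$\gamma^*:=\max\{\underline{\mu}[\gamma](p):p\in\mathcal{C}^1_T(\mathbb{R})\}=\underline{\mu}[\gamma](p^* )=\min\{\overline{\mu}[\gamma](p):p\in\mathcal{C}^1_{T,0}(\mathbb{R})\}=\overline{\mu}[\gamma](p^* ),$$ and $\gamma^*=0$ if and only if $\widehat{\gamma}(t)\equiv 0$.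
   Context: For $k\in\{0,1\}$, $\mathcal{C}^k_T(\mathbb{R})$ denotes the space of $T$-periodic real functions on $\mathbb{R}$ of class $\mathcal{C}^k$, and $\mathcal{C}^k_{T,0}(\mathbb{R})\subset\mathcal{C}^k_T(\mathbb{R})$ the subspace of functions $p$ with zero average, $\int_0^T p(t)\,dt=0$. These spaces carry the usual $\mathcal{C}^k$ norm. For $\gamma\in\mathcal{C}^1_T(\mathbb{R})$ put $\overline{\gamma}:=\frac1T\int_0^T\gamma(t)\,dt$ and $\widehat{\gamma}(t):=\gamma(t)-\overline{\gamma}$. The functionals are $$\underline{\mu}[\gamma](p):=-\max_{t\in[0,T]}\{p(t)^2+\widehat{\gamma}(t)-p'(t)\},\qquad p\in\mathcal{C}^1_T(\mathbb{R}),$$ $$\overline{\mu}[\gamma](p):=\Big(\int_0^T e^{-2\int_0^t p(s)\,ds}\,dt\Big)^{-1}\int_0^T e^{-2\int_0^t p(s)\,ds}\big(p(t)^2-\widehat{\gamma}(t)\big)\,dt,\qquad p\in\mathcal{C}^1_{T,0}(\mathbb{R}).$$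
   Formalization: The bound that the upper functional is ≤ 0 for every q is false (γ=0, T=2π, q=sin gives a positive value; it fails for every γ) and is replaced by: the lower functional is ≤ 0 for every p, and γ* ≤ 0. *)

(* Defs.v *)
From Stdlib Require Import Reals Lra.
From Coquelicot Require Import Coquelicot.

Open Scope R_scope.

(** Maximum over [[0,T]], encoded as a supremum; see [max_on_attained]. *)
Definition max_on (T : R) (f : R -> R) : R :=
  real (Lub_Rbar (fun y => exists t, 0 <= t <= T /\ y = f t)).

Definition is_max (A : R -> Prop) (m : R) : Prop :=
  A m /\ forall y, A y -> y <= m.

Definition is_min (A : R -> Prop) (m : R) : Prop :=
  A m /\ forall y, A y -> m <= y.

Lemma max_on_attained (T : R) (f : R -> R) :
  0 <= T -> (forall t, continuous f t) ->
  is_max (fun y => exists t, 0 <= t <= T /\ y = f t) (max_on T f).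
Proof.
intros hT hf.
destruct (continuity_ab_maj f 0 T hT) as [x [Hx Ix]].
{ intros c _. apply continuity_pt_filterlim. apply hf. }
assert (E : max_on T f = f x).
{ unfold max_on. rewrite (is_lub_Rbar_unique _ (Finite (f x))); [reflexivity|].
  split.
  - intros y [t [It ->]]. simpl. now apply Hx.
  - intros b Hb. apply Hb. now exists x. }
rewrite E. split.
- now exists x.
- intros y [t [It ->]]. now apply Hx.
Qed.

Definition C1_norm (T : R) (f : R -> R) : R :=
  max_on T (fun t => Rabs (f t)) + max_on T (fun t => Rabs (Derive f t)).

Record C1per (T : R) : Type := MkC1per {
  C1per_fun :> R -> R;
  C1per_ex_derive : forall t, ex_derive C1per_fun t;
  C1per_continuous_Derive : forall t, continuous (Derive C1per_fun) t;
  C1per_periodic : forall t, C1per_fun (t + T) = C1per_fun t }.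

Record C1per0 (T : R) : Type := MkC1per0 {
  C1per0_C1per :> C1per T;
  C1per0_zero_average : RInt C1per0_C1per 0 T = 0 }.

Lemma max_on_0 (T : R) (f : R -> R) : (forall t, f t = 0) -> max_on T f = 0.
Proof.
intros hf. unfold max_on. destruct (Rle_lt_dec 0 T) as [hT|hT].
- rewrite (is_lub_Rbar_unique _ (Finite 0)); [reflexivity|]. split.
  + intros y [t [_ ->]]. rewrite hf. simpl. lra.
  + intros b Hb. apply Hb. exists 0. split; [lra | now rewrite hf].
- rewrite (is_lub_Rbar_unique _ m_infty); [reflexivity|]. split.
  + intros y [t [It _]]. lra.
  + now intros [b| |] _.
Qed.

Lemma max_on_ext (T : R) (f g : R -> R) :
  (forall t, f t = g t) -> max_on T f = max_on T g.
Proof.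
intros h. unfold max_on. f_equal. apply Lub_Rbar_eqset.
intros y; split; intros [t [It ->]]; exists t; split; auto.
Qed.

Lemma max_on_triangle (T : R) (f g h : R -> R) :
  (forall t, continuous f t) -> (forall t, continuous g t) ->
  (forall t, continuous h t) -> (forall t, f t <= g t + h t) ->
  max_on T f <= max_on T g + max_on T h.
Proof.
intros hf hg hh hle. destruct (Rle_lt_dec 0 T) as [hT|hT].
- destruct (max_on_attained T f hT hf) as [[t [It ->]] _].
  assert (Hg : g t <= max_on T g)
    by (apply (max_on_attained T g hT hg); now exists t).
  assert (Hh : h t <= max_on T h)
    by (apply (max_on_attained T h hT hh); now exists t).
  specialize (hle t). lra.
- assert (E : forall k : R -> R, max_on T k = 0).
  { intros k. unfold max_on.
    rewrite (is_lub_Rbar_unique _ m_infty); [reflexivity|]. split.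
    + intros y [t [It _]]. lra.
    + now intros [b| |] _. }
  rewrite !E. lra.
Qed.

Lemma C1per_continuous (T : R) (p : C1per T) (t : R) : continuous p t.
Proof. apply (ex_derive_continuous p t), C1per_ex_derive. Qed.

Definition C1_ball (T : R) (p : C1per T) (e : R) (q : C1per T) : Prop :=
  C1_norm T (fun t => p t - q t) < e.

Lemma C1_norm_minus (T : R) (p q : C1per T) :
  C1_norm T (fun t => p t - q t)
  = max_on T (fun t => Rabs (p t - q t))
    + max_on T (fun t => Rabs (Derive p t - Derive q t)).
Proof.
unfold C1_norm. f_equal. apply max_on_ext. intros t.
now rewrite Derive_minus by apply C1per_ex_derive.
Qed.

Lemma C1_ball_center (T : R) (p : C1per T) (e : posreal) : C1_ball T p e p.
Proof.
unfold C1_ball. rewrite C1_norm_minus, !max_on_0.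
- destruct e; simpl; lra.
- intros t. rewrite Rminus_diag. apply Rabs_R0.
- intros t. rewrite Rminus_diag. apply Rabs_R0.
Qed.

Lemma C1_ball_sym (T : R) (p q : C1per T) (e : R) :
  C1_ball T p e q -> C1_ball T q e p.
Proof.
unfold C1_ball. rewrite !C1_norm_minus.
rewrite (max_on_ext T (fun t => Rabs (p t - q t)) (fun t => Rabs (q t - p t)))
  by (intros t; apply Rabs_minus_sym).
rewrite (max_on_ext T (fun t => Rabs (Derive p t - Derive q t))
           (fun t => Rabs (Derive q t - Derive p t)))
  by (intros t; apply Rabs_minus_sym).
auto.
Qed.

Lemma continuous_Rabs_minus (f g : R -> R) (t : R) :
  continuous f t -> continuous g t -> continuous (fun t => Rabs (f t - g t)) t.
Proof.
intros hf hg. apply (continuous_comp (fun t => f t - g t) Rabs).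
- now apply (continuous_minus f g).
- apply continuous_Rabs.
Qed.

Lemma C1_ball_triangle (T : R) (p q r : C1per T) (e1 e2 : R) :
  C1_ball T p e1 q -> C1_ball T q e2 r -> C1_ball T p (e1 + e2) r.
Proof.
unfold C1_ball. rewrite !C1_norm_minus. intros H1 H2.
assert (A : forall f g h : R -> R,
  (forall t, continuous f t) -> (forall t, continuous g t) ->
  (forall t, continuous h t) ->
  max_on T (fun t => Rabs (f t - h t))
  <= max_on T (fun t => Rabs (f t - g t)) + max_on T (fun t => Rabs (g t - h t))).
{ intros f g h hf hg hh. apply max_on_triangle;
    try (intros t; apply continuous_Rabs_minus; auto).
  intros t. replace (f t - h t) with ((f t - g t) + (g t - h t)) by ring.
  apply Rabs_triang. }
pose proof (A p q r (C1per_continuous T p) (C1per_continuous T q)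
              (C1per_continuous T r)).
pose proof (A (Derive p) (Derive q) (Derive r)
  (C1per_continuous_Derive T p) (C1per_continuous_Derive T q)
  (C1per_continuous_Derive T r)).
lra.
Qed.

Lemma Derive_zero (t : R) : Derive (fun _ : R => 0) t = 0.
Proof. apply Derive_const. Qed.

Definition C1per_zero (T : R) : C1per T :=
  MkC1per T (fun _ => 0)
    (fun t => ex_derive_const 0 t)
    (fun t => continuous_ext (fun _ => 0) _ t
                (fun s => eq_sym (Derive_zero s)) (continuous_const 0 t))
    (fun _ => eq_refl).

Lemma RInt_zero (T : R) : RInt (C1per_zero T) 0 T = 0.
Proof. simpl. rewrite RInt_const. apply Rmult_0_r. Qed.

Definition C1per0_zero (T : R) : C1per0 T :=
  MkC1per0 T (C1per_zero T) (RInt_zero T).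

Definition C1per_UniformSpace_mixin (T : R) : UniformSpace.mixin_of (C1per T) :=
  UniformSpace.Mixin (C1per T) (C1per_zero T) (C1_ball T)
    (C1_ball_center T) (C1_ball_sym T) (C1_ball_triangle T).

Canonical C1per_UniformSpace (T : R) : UniformSpace :=
  UniformSpace.Pack (C1per T) (C1per_UniformSpace_mixin T) (C1per T).

Definition C1per0_UniformSpace_mixin (T : R) : UniformSpace.mixin_of (C1per0 T) :=
  UniformSpace.Mixin (C1per0 T) (C1per0_zero T) (fun p e q => C1_ball T p e q)
    (fun p => C1_ball_center T p) (fun p q => C1_ball_sym T p q)
    (fun p q r => C1_ball_triangle T p q r).

Canonical C1per0_UniformSpace (T : R) : UniformSpace :=
  UniformSpace.Pack (C1per0 T) (C1per0_UniformSpace_mixin T) (C1per0 T).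

Definition average (T : R) (g : R -> R) : R := / T * RInt g 0 T.

Definition hat (T : R) (g : R -> R) (t : R) : R := g t - average T g.

Definition mu_lower (T : R) (gamma p : C1per T) : R :=
  - max_on T (fun t => p t ^ 2 + hat T gamma t - Derive p t).

Definition weight (p : R -> R) (t : R) : R := exp (- 2 * RInt p 0 t).

Definition mu_upper (T : R) (gamma : C1per T) (p : C1per0 T) : R :=
  / RInt (weight p) 0 T
  * RInt (fun t => weight p t * (p t ^ 2 - hat T gamma t)) 0 T.

(* Main.v *)
Require Import Defs.
From Stdlib Require Import Reals ZArith Lra Lia.
From Coquelicot Require Import Coquelicot.

(** Write [f] for the zero-mean part of [gamma]. For a positive function [psi] and
    [p = - psi' / psi] one has [p^2 + f - p' = (psi'' + f psi) / psi], while
    [exp (- 2 int q)] is the square of the function whose logarithmic derivative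
    is [- q], and the upper functional is its Rayleigh quotient for [- psi'' - f psi].
    Both functionals thus estimate the principal periodic eigenvalue of that
    operator, from below and from above.

    The comparison needs no eigenvalue. With [w] the weight of [q] and [m] the
    lower functional at [p], the pointwise inequality [- f >= m + p^2 - p'] and
    the identity [int w p' = 2 int w q p] give
    [int w (q^2 - f) >= m int w + int w (q - p)^2] ([lower_le_upper]). For [q = 0]
    the upper functional vanishes, so the lower one is nonpositive. Equality
    holds when [p = q] solves [p' = p^2 + f - mu] ([riccati_optimal]), and it
    remains to find a periodic solution of zero mean of this equation, for some
    [mu] ([riccati_principal]).

    Such a solution comes from the linear equation [u'' = (mu - f) u], with its
    fundamental solutions [C] and [S]. These are built by Picard iteration
    ([is_derive_sol]) and depend continuously on [mu] ([sol_lipschitz]). Consider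
    the [mu] for which the trace [C(T) + S'(T)] is at least [2] and [S > 0] on
    [(0,T]]. This set contains a bound of [|f|], since the equation is then
    convex. It is bounded below by [0]: for these [mu] there is a solution
    positive on [[0,T]] for which [p = - u' / u] does not increase over the
    period, and integrating [p' = p^2 + f - mu] gives [mu >= 0]. It is closed, and
    open to the left wherever the trace exceeds [2]. So its infimum has trace
    exactly [2] ([principal_exists]), and the positive solution is then periodic;
    minus its logarithmic derivative is the required [p].

    If the optimal value is [0], then [mu = 0] and [p' = p^2 + f]; subtracting from
    [p] the periodic primitive of [f] leaves a periodic monotone function, so
    [p = 0] and [f = 0] ([riccati_zero]). *)

Open Scope R_scope.

(** * Elementary calculus *)

Lemma is_derive_cont (f : R -> R) (t l : R) : is_derive f t l -> continuous f t.
Proof. intros h. apply (ex_derive_continuous f t). now exists l. Qed.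

Lemma cont_ex_RInt (f : R -> R) (a b : R) :
  (forall t, continuous f t) -> ex_RInt f a b.
Proof. intros h. apply (ex_RInt_continuous (V := R_CompleteNormedModule)). auto. Qed.

Lemma is_derive_primitive (f : R -> R) (t : R) :
  (forall s, continuous f s) -> is_derive (fun s => RInt f 0 s) t (f t).
Proof.
intros h. apply (is_derive_RInt f (fun s => RInt f 0 s) 0 t); [|apply h].
apply filter_forall. intros s.
apply (RInt_correct (V := R_CompleteNormedModule)). now apply cont_ex_RInt.
Qed.

Lemma RInt_at_0 (f : R -> R) : RInt f 0 0 = 0.
Proof. apply (RInt_point (V := R_CompleteNormedModule)). Qed.

Lemma RInt_is_derive (f g : R -> R) (a b : R) :
  (forall t, is_derive f t (g t)) -> (forall t, continuous g t) ->
  RInt g a b = f b - f a.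
Proof.
intros h hc. apply is_RInt_unique.
apply (is_RInt_derive (V := R_CompleteNormedModule) f g); auto.
Qed.

Lemma cont_mult (f g : R -> R) (t : R) :
  continuous f t -> continuous g t -> continuous (fun s => f s * g s) t.
Proof. intros. now apply (continuous_mult f g). Qed.

Lemma cont_plus (f g : R -> R) (t : R) :
  continuous f t -> continuous g t -> continuous (fun s => f s + g s) t.
Proof. intros. now apply (continuous_plus f g). Qed.

Lemma cont_minus (f g : R -> R) (t : R) :
  continuous f t -> continuous g t -> continuous (fun s => f s - g s) t.
Proof. intros. now apply (continuous_minus f g). Qed.

Lemma cont_sqr (f : R -> R) (t : R) :
  continuous f t -> continuous (fun s => f s ^ 2) t.
Proof.
intros. apply (continuous_ext (fun s => f s * f s)).
- intros s. simpl. ring.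
- now apply cont_mult.
Qed.

Lemma bound_nonneg (g : R -> R) (B : R) : (forall t, Rabs (g t) <= B) -> 0 <= B.
Proof. intros h. apply Rle_trans with (2 := h 0). apply Rabs_pos. Qed.

Lemma incr_of_derive (f g : R -> R) (a b : R) :
  a <= b -> (forall t, a <= t <= b -> is_derive f t (g t)) ->
  (forall t, a <= t <= b -> 0 <= g t) -> f a <= f b.
Proof.
intros hab hd hg.
destruct (MVT_gen f a b g) as [c [Ic E]];
  rewrite ?Rmin_left, ?Rmax_right in * by lra.
- intros t It. apply hd. lra.
- intros t It. apply continuity_pt_filterlim. apply (is_derive_cont f t (g t)). auto.
- specialize (hg c Ic). assert (0 <= g c * (b - a)) by (apply Rmult_le_pos; lra).
  lra.
Qed.

Lemma strict_incr_of_derive (f g : R -> R) (a b : R) :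
  a < b -> (forall t, a <= t <= b -> is_derive f t (g t)) ->
  (forall t, a <= t <= b -> 0 < g t) -> f a < f b.
Proof.
intros hab hd hg.
destruct (MVT_gen f a b g) as [c [Ic E]];
  rewrite ?Rmin_left, ?Rmax_right in * by lra.
- intros t It. apply hd. lra.
- intros t It. apply continuity_pt_filterlim. apply (is_derive_cont f t (g t)). auto.
- specialize (hg c Ic). assert (0 < g c * (b - a)) by (apply Rmult_lt_0_compat; lra).
  lra.
Qed.

Lemma const_of_derive (f : R -> R) :
  (forall t, is_derive f t 0) -> forall t, f t = f 0.
Proof.
intros h t.
destruct (MVT_gen f 0 t (fun _ => 0)) as [c [_ E]]; [auto| |lra].
intros s _. apply continuity_pt_filterlim. now apply (is_derive_cont f s 0).
Qed.

(** * Existence for linear second order equations *)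

Lemma cosh_ge_1 (s : R) : 1 <= cosh s.
Proof.
unfold cosh. pose proof (exp_ineq1_le s). pose proof (exp_ineq1_le (- s)). lra.
Qed.

(** An integration from [0] costs a function dominated by [cosh (k t)] only a
    factor [1/k]. Measured against this weight, the Volterra operator of a
    linear equation is therefore a contraction on the whole line at once, with
    no restriction to short intervals and no gluing. *)
Lemma RInt_le_cosh (h : R -> R) (A k : R) :
  0 < k -> 0 <= A -> (forall t, continuous h t) ->
  (forall t, Rabs (h t) <= A * cosh (k * t)) ->
  forall t, Rabs (RInt h 0 t) <= A / k * cosh (k * t).
Proof.
intros hk hA hc hb t.
assert (D : forall e s, is_derive (fun s => A / k * sinh (k * s) + e * RInt h 0 s) s
                          (A * cosh (k * s) + e * h s)).
{ intros e s.
  replace (A * cosh (k * s)) with (A / k * (k * cosh (k * s))) by (field; lra).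
  apply (is_derive_plus (fun s => A / k * sinh (k * s))); apply is_derive_scal.
  - apply (is_derive_comp sinh (fun s => k * s)).
    + apply is_derive_Reals, derivable_pt_lim_sinh.
    + auto_derive; [auto|ring].
  - now apply is_derive_primitive. }
assert (S : sinh (k * 0) = 0).
{ unfold sinh. rewrite Rmult_0_r, Ropp_0. lra. }
assert (P : Rabs (sinh (k * t)) <= cosh (k * t)).
{ unfold sinh, cosh. pose proof (exp_pos (k * t)). pose proof (exp_pos (- (k * t))).
  apply Rabs_le. lra. }
assert (Q : Rabs (RInt h 0 t) <= A / k * Rabs (sinh (k * t))).
{ pose proof (D 1) as D1. pose proof (D (-1)) as D2.
  assert (N1 : forall s, 0 <= A * cosh (k * s) + 1 * h s).
  { intros s. specialize (hb s). apply Rabs_le_between in hb. lra. }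
  assert (N2 : forall s, 0 <= A * cosh (k * s) + -1 * h s).
  { intros s. specialize (hb s). apply Rabs_le_between in hb. lra. }
  destruct (Rle_dec 0 t) as [ht|ht].
  - pose proof (incr_of_derive _ _ 0 t ht (fun s _ => D1 s) (fun s _ => N1 s)) as H1.
    pose proof (incr_of_derive _ _ 0 t ht (fun s _ => D2 s) (fun s _ => N2 s)) as H2.
    cbv beta in H1, H2. rewrite RInt_at_0, S in H1, H2.
    apply Rle_trans with (A / k * sinh (k * t)).
    + apply Rabs_le. lra.
    + apply Rmult_le_compat_l; [|apply Rle_abs].
      apply Rmult_le_pos; [lra|]. left. now apply Rinv_0_lt_compat.
  - assert (ht' : t <= 0) by lra.
    pose proof (incr_of_derive _ _ t 0 ht' (fun s _ => D1 s) (fun s _ => N1 s)) as H1.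
    pose proof (incr_of_derive _ _ t 0 ht' (fun s _ => D2 s) (fun s _ => N2 s)) as H2.
    cbv beta in H1, H2. rewrite RInt_at_0, S in H1, H2.
    apply Rle_trans with (A / k * - sinh (k * t)).
    + apply Rabs_le. lra.
    + apply Rmult_le_compat_l.
      * apply Rmult_le_pos; [lra|]. left. now apply Rinv_0_lt_compat.
      * rewrite <- Rabs_Ropp. apply Rle_abs. }
apply Rle_trans with (1 := Q). apply Rmult_le_compat_l; [|exact P].
apply Rmult_le_pos; [lra|]. left. now apply Rinv_0_lt_compat.
Qed.

Definition volterra (a u : R -> R) (t : R) : R :=
  RInt (fun s => RInt (fun r => a r * u r) 0 s) 0 t.

Lemma primitive_continuous (f : R -> R) :
  (forall s, continuous f s) -> forall t, continuous (fun s => RInt f 0 s) t.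
Proof.
intros h t. apply (is_derive_cont _ t (f t)). now apply is_derive_primitive.
Qed.

Lemma volterra_continuous (a u : R -> R) :
  (forall t, continuous a t) -> (forall t, continuous u t) ->
  forall t, continuous (volterra a u) t.
Proof.
intros ha hu t. apply primitive_continuous. apply primitive_continuous.
intros s. now apply cont_mult.
Qed.

Lemma volterra_minus (a u v : R -> R) (t : R) :
  (forall t, continuous a t) -> (forall t, continuous u t) ->
  (forall t, continuous v t) ->
  volterra a u t - volterra a v t = volterra a (fun s => u s - v s) t.
Proof.
intros ha hu hv. unfold volterra.
assert (I : forall w : R -> R, (forall t, continuous w t) ->
              forall s, continuous (fun s => a s * w s) s).
{ intros w hw s. now apply cont_mult. }
assert (J : forall w : R -> R, (forall t, continuous w t) ->
              forall s, continuous (fun s => RInt (fun r => a r * w r) 0 s) s).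
{ intros w hw s. apply primitive_continuous. auto. }
symmetry. rewrite <- (RInt_minus (V := R_CompleteNormedModule));
  try (apply cont_ex_RInt; apply J; auto).
apply (RInt_ext (V := R_CompleteNormedModule)). intros s _.
rewrite <- (RInt_minus (V := R_CompleteNormedModule));
  try (apply cont_ex_RInt; apply I; auto).
apply (RInt_ext (V := R_CompleteNormedModule)). intros r _.
unfold minus, plus, opp; simpl. ring.
Qed.

Lemma volterra_contract (a u : R -> R) (K k B : R) :
  0 < k -> 2 * K <= k ^ 2 -> 0 <= B ->
  (forall t, continuous a t) -> (forall t, continuous u t) ->
  (forall t, Rabs (a t) <= K) ->
  (forall t, Rabs (u t) <= B * cosh (k * t)) ->
  forall t, Rabs (volterra a u t) <= B / 2 * cosh (k * t).
Proof.
intros hk hK hB ha hu haK huB t.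
pose proof (bound_nonneg a K haK) as K0.
assert (I : forall s, continuous (fun s => a s * u s) s)
  by (intros s; now apply cont_mult).
assert (KB : 0 <= K * B) by (now apply Rmult_le_pos).
assert (KBk : 0 <= K * B / k).
{ apply Rmult_le_pos; [lra|]. left. now apply Rinv_0_lt_compat. }
apply Rle_trans with (K * B / k / k * cosh (k * t)).
- apply RInt_le_cosh; auto.
  + apply primitive_continuous. auto.
  + apply RInt_le_cosh; auto.
    intros s. rewrite Rabs_mult, Rmult_assoc.
    apply Rmult_le_compat; auto using Rabs_pos.
- apply Rmult_le_compat_r; [pose proof (cosh_ge_1 (k * t)); lra|].
  replace (K * B / k / k) with (K / k ^ 2 * B) by (field; lra).
  assert (K / k ^ 2 <= / 2).
  { apply Rmult_le_reg_r with (k ^ 2); [apply pow_lt; lra|].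
    unfold Rdiv. rewrite Rmult_assoc, Rinv_l; [lra|]. apply pow_nonzero. lra. }
  replace (B / 2) with (/ 2 * B) by field. now apply Rmult_le_compat_r.
Qed.

Fixpoint picard (a : R -> R) (alpha beta : R) (n : nat) : R -> R :=
  match n with
  | O => fun _ => 0
  | S n => fun t => alpha + beta * t + volterra a (picard a alpha beta n) t
  end.

Definition sol (a : R -> R) (alpha beta t : R) : R :=
  real (Lim_seq (fun n => picard a alpha beta n t)).

Definition dsol (a : R -> R) (alpha beta t : R) : R :=
  beta + RInt (fun s => a s * sol a alpha beta s) 0 t.

Section Existence.

Variables (a : R -> R) (K alpha beta : R).
Hypothesis a_cont : forall t, continuous a t.
Hypothesis a_bound : forall t, Rabs (a t) <= K.

(* [2 K <= k^2] makes the contraction factor [1/2]; [B] is twice the weighted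
   size of the affine starting term, so the ball of radius [B] is preserved. *)
Let k := 2 * K + 1.
Let B := 2 * (Rabs alpha + Rabs beta).

Lemma rate_bounds : 1 <= k /\ 2 * K <= k ^ 2.
Proof. pose proof (bound_nonneg a K a_bound). unfold k. split; [lra|]. nra. Qed.

Lemma radius_nonneg : 0 <= B.
Proof. unfold B. pose proof (Rabs_pos alpha). pose proof (Rabs_pos beta). lra. Qed.

Lemma affine_bound (t : R) : Rabs (alpha + beta * t) <= B / 2 * cosh (k * t).
Proof.
destruct rate_bounds as [k1 _].
assert (I : Rabs t <= cosh (k * t)).
{ pose proof (RInt_le_cosh (fun _ => 1) 1 k) as H.
  assert (E : forall t, RInt (fun _ => 1) 0 t = t).
  { intros s. rewrite (RInt_const (V := R_CompleteNormedModule)).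
    unfold scal; simpl; unfold mult; simpl. ring. }
  specialize (H ltac:(lra) ltac:(lra) (fun t => continuous_const 1 t)).
  specialize (H ltac:(intros s; cbv beta; rewrite Rabs_R1; pose proof (cosh_ge_1 (k * s)); lra) t).
  rewrite E in H. apply Rle_trans with (1 := H).
  pose proof (cosh_ge_1 (k * t)).
  replace (cosh (k * t)) with (1 * cosh (k * t)) at 2 by ring.
  apply Rmult_le_compat_r; [lra|].
  apply Rmult_le_reg_r with k; [lra|]. unfold Rdiv. rewrite Rmult_assoc, Rinv_l; lra. }
pose proof (cosh_ge_1 (k * t)) as C.
apply Rle_trans with (1 := Rabs_triang _ _). rewrite Rabs_mult. unfold B.
replace (2 * (Rabs alpha + Rabs beta) / 2) with (Rabs alpha + Rabs beta) by field.
pose proof (Rabs_pos alpha). pose proof (Rabs_pos beta). nra.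
Qed.

Lemma picard_continuous (n : nat) (t : R) : continuous (picard a alpha beta n) t.
Proof.
revert t. induction n as [|n IH]; intros t; simpl.
- apply continuous_const.
- apply cont_plus; [|apply volterra_continuous; auto].
  apply (is_derive_cont _ t beta). auto_derive; [auto|ring].
Qed.

Lemma picard_bound (n : nat) (t : R) :
  Rabs (picard a alpha beta n t) <= B * cosh (k * t).
Proof.
destruct rate_bounds as [k1 k2]. pose proof radius_nonneg as hB.
revert t. induction n as [|n IH]; intros t; simpl.
- rewrite Rabs_R0. pose proof (cosh_ge_1 (k * t)). apply Rmult_le_pos; lra.
- apply Rle_trans with (1 := Rabs_triang _ _).
  pose proof (affine_bound t).
  pose proof (volterra_contract a (picard a alpha beta n) K k B ltac:(lra) k2 hB
    a_cont (picard_continuous n) a_bound IH t). lra.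
Qed.

(** The estimate for [n = 0] is the uniform bound on the iterates; each further
    step gains the contraction factor. *)
Lemma picard_dist (n m : nat) (t : R) :
  Rabs (picard a alpha beta (n + m) t - picard a alpha beta n t)
  <= B * (/ 2) ^ n * cosh (k * t).
Proof.
destruct rate_bounds as [k1 k2]. pose proof radius_nonneg as hB.
revert t. induction n as [|n IH]; intros t.
- simpl. rewrite Rminus_0_r, Rmult_1_r. apply picard_bound.
- simpl plus. simpl picard.
  replace (_ - _) with
    (volterra a (picard a alpha beta (n + m)) t - volterra a (picard a alpha beta n) t)
    by ring.
  rewrite volterra_minus by (auto using picard_continuous).
  replace (B * (/ 2) ^ S n) with (B * (/ 2) ^ n / 2) by (simpl; field).
  apply (volterra_contract a _ K); auto; try lra.
  + apply Rmult_le_pos; [lra|]. apply pow_le. lra.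
  + intros s. apply cont_minus; apply picard_continuous.
Qed.

Lemma geom_small (C eps : R) : 0 <= C -> 0 < eps -> exists N, forall n, (N <= n)%nat ->
  C * (/ 2) ^ n < eps.
Proof.
intros hC he.
destruct (pow_lt_1_zero (/ 2)) with (y := eps / (C + 1)) as [N HN].
- rewrite Rabs_pos_eq; lra.
- apply Rdiv_lt_0_compat; lra.
- exists N. intros n hn. specialize (HN n hn).
  rewrite Rabs_pos_eq in HN by (apply pow_le; lra).
  assert (P : 0 <= (/ 2) ^ n) by (apply pow_le; lra).
  apply Rmult_lt_compat_r with (r := C + 1) in HN; [|lra].
  unfold Rdiv in HN. rewrite Rmult_assoc, Rinv_l in HN by lra. nra.
Qed.

Lemma picard_cv (t : R) : is_lim_seq (fun n => picard a alpha beta n t) (sol a alpha beta t).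
Proof.
apply Lim_seq_correct'. apply ex_lim_seq_cauchy_corr. intros eps.
assert (C0 : 0 <= B * cosh (k * t)).
{ apply Rmult_le_pos; [apply radius_nonneg|]. pose proof (cosh_ge_1 (k * t)). lra. }
destruct (geom_small (B * cosh (k * t)) (eps / 2)) as [N HN]; auto.
{ destruct eps; simpl; lra. }
exists N. intros n m hn hm.
pose proof (picard_dist N (n - N) t) as H1. pose proof (picard_dist N (m - N) t) as H2.
replace (N + (n - N))%nat with n in H1 by lia.
replace (N + (m - N))%nat with m in H2 by lia.
specialize (HN N (le_n N)).
apply Rabs_le_between in H1. apply Rabs_le_between in H2.
apply Rabs_def1; lra.
Qed.

Lemma sol_dist (n : nat) (t : R) :
  Rabs (sol a alpha beta t - picard a alpha beta n t) <= B * (/ 2) ^ n * cosh (k * t).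
Proof.
apply (is_lim_seq_le
  (fun m => Rabs (picard a alpha beta (n + m) t - picard a alpha beta n t))
  (fun _ => B * (/ 2) ^ n * cosh (k * t))
  (Rabs (sol a alpha beta t - picard a alpha beta n t)) (B * (/ 2) ^ n * cosh (k * t))).
- intros m. apply picard_dist.
- apply (is_lim_seq_abs _ (Finite (sol a alpha beta t - picard a alpha beta n t))).
  apply is_lim_seq_minus'; [|apply is_lim_seq_const].
  apply (is_lim_seq_ext (fun m => picard a alpha beta (m + n) t)).
  + intros m. now rewrite Nat.add_comm.
  + apply (is_lim_seq_incr_n (fun m => picard a alpha beta m t)). apply picard_cv.
- apply is_lim_seq_const.
Qed.

Lemma cosh_locally_bounded (t : R) : exists C, 0 <= C /\
  forall s, Rabs (s - t) < 1 -> cosh (k * s) <= C.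
Proof.
destruct rate_bounds as [k1 _].
exists (exp (k * (Rabs t + 1))). split; [left; apply exp_pos|]. intros s hs.
apply Rabs_def2 in hs. pose proof (Rle_abs t). pose proof (Rle_abs (- t)).
rewrite Rabs_Ropp in H0.
assert (M : forall x, x <= k * (Rabs t + 1) -> exp x <= exp (k * (Rabs t + 1))).
{ intros x [hx| ->]; [left; now apply exp_increasing|lra]. }
unfold cosh. pose proof (M (k * s)). pose proof (M (- (k * s))).
assert (k * s <= k * (Rabs t + 1)) by (apply Rmult_le_compat_l; lra).
assert (k * (- s) <= k * (Rabs t + 1)) by (apply Rmult_le_compat_l; lra).
lra.
Qed.

Lemma sol_continuous (t : R) : continuous (sol a alpha beta) t.
Proof.
apply continuity_pt_filterlim.
apply (CVU_continuity (fun n => picard a alpha beta n) _ t (mkposreal 1 Rlt_0_1)).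
- intros eps heps.
  destruct (cosh_locally_bounded t) as [C [C0 HC]].
  destruct (geom_small (B * C) eps) as [N HN]; auto.
  { apply Rmult_le_pos; auto using radius_nonneg. }
  exists N. intros n y hn hy.
  apply Rle_lt_trans with (1 := sol_dist n y).
  apply Rle_lt_trans with (2 := HN n hn).
  replace (B * C * (/ 2) ^ n) with (B * (/ 2) ^ n * C) by ring.
  apply Rmult_le_compat_l; [|now apply HC].
  apply Rmult_le_pos; [apply radius_nonneg|]. apply pow_le. lra.
- intros n y _. apply continuity_pt_filterlim. apply picard_continuous.
- unfold Boule. simpl. rewrite Rminus_diag, Rabs_R0. lra.
Qed.

(** The Volterra operator is continuous for the weighted norm, so the integral
    equation survives the passage to the limit in the iteration. *)
Lemma sol_integral (t : R) :
  sol a alpha beta t = alpha + beta * t + volterra a (sol a alpha beta) t.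
Proof.
destruct rate_bounds as [k1 k2].
assert (L : is_lim_seq (fun n => picard a alpha beta (S n) t)
              (alpha + beta * t + volterra a (sol a alpha beta) t)).
{ simpl. apply is_lim_seq_plus'; [apply is_lim_seq_const|].
  apply is_lim_seq_spec. intros eps.
  assert (C0 : 0 <= B * cosh (k * t)).
  { apply Rmult_le_pos; [apply radius_nonneg|]. pose proof (cosh_ge_1 (k * t)). lra. }
  destruct (geom_small (B * cosh (k * t)) eps C0 (cond_pos eps)) as [N HN].
  exists N. intros n hn. specialize (HN n hn).
  rewrite <- Rabs_Ropp, Ropp_minus_distr.
  rewrite volterra_minus by (auto using picard_continuous, sol_continuous).
  assert (P : 0 <= B * (/ 2) ^ n)
    by (apply Rmult_le_pos; [apply radius_nonneg|apply pow_le; lra]).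
  apply Rle_lt_trans with (B * (/ 2) ^ n / 2 * cosh (k * t)).
  - apply (volterra_contract a _ K); auto; try lra.
    + intros s. apply cont_minus; auto using picard_continuous, sol_continuous.
    + apply sol_dist.
  - apply Rle_lt_trans with (2 := HN).
    assert (0 <= B * (/ 2) ^ n * cosh (k * t)).
    { apply Rmult_le_pos; auto. pose proof (cosh_ge_1 (k * t)). lra. }
    lra. }
apply (is_lim_seq_incr_1 (fun n => picard a alpha beta n t)) in L.
pose proof (is_lim_seq_unique _ _ L) as E1.
pose proof (is_lim_seq_unique _ _ (picard_cv t)) as E2.
rewrite E1 in E2. now injection E2.
Qed.

Lemma is_derive_sol (t : R) : is_derive (sol a alpha beta) t (dsol a alpha beta t).
Proof.
apply (is_derive_ext (fun t => alpha + beta * t + volterra a (sol a alpha beta) t)).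
{ intros s. symmetry. apply sol_integral. }
unfold dsol.
apply (is_derive_plus (fun t => alpha + beta * t)).
- auto_derive; [auto|ring].
- apply is_derive_primitive. apply primitive_continuous.
  intros s. apply cont_mult; auto using sol_continuous.
Qed.

Lemma is_derive_dsol (t : R) :
  is_derive (dsol a alpha beta) t (a t * sol a alpha beta t).
Proof.
unfold dsol. rewrite <- (Rplus_0_l (a t * _)).
apply (is_derive_plus (fun _ => beta)).
- apply (is_derive_const (K := R_AbsRing) (V := R_NormedModule)).
- apply (is_derive_primitive (fun s => a s * sol a alpha beta s)).
  intros s. apply cont_mult; auto using sol_continuous.
Qed.

Lemma sol_0 : sol a alpha beta 0 = alpha.
Proof. rewrite sol_integral. unfold volterra. rewrite RInt_at_0. ring. Qed.

Lemma dsol_0 : dsol a alpha beta 0 = beta.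
Proof. unfold dsol. rewrite RInt_at_0. ring. Qed.

End Existence.

(** * Wronskians, growth and dependence on the parameter *)

Definition solves (a u v : R -> R) : Prop :=
  forall t, is_derive u t (v t) /\ is_derive v t (a t * u t).

Ltac known_derive :=
  auto_derive;
  [ repeat split; try (eexists; eassumption); try assumption
  | repeat match goal with
    | H : is_derive ?f ?t ?l |- _ =>
        change (Derive (fun x => f x) t) with (Derive f t);
        rewrite ?(is_derive_unique f t l H); clear H
    end ].

Lemma sol_solves (a : R -> R) (K alpha beta : R) :
  (forall t, continuous a t) -> (forall t, Rabs (a t) <= K) ->
  solves a (sol a alpha beta) (dsol a alpha beta).
Proof.
intros ha hK t. split.
- now apply is_derive_sol with K.
- now apply is_derive_dsol with K.
Qed.

Lemma wronskian_const (a u v y z : R -> R) :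
  solves a u v -> solves a y z ->
  forall t, u t * z t - v t * y t = u 0 * z 0 - v 0 * y 0.
Proof.
intros hu hy. apply const_of_derive. intros t.
destruct (hu t) as [D1 D2], (hy t) as [D3 D4].
known_derive. ring.
Qed.

(** Cramer's rule with the constant Wronskians expresses every solution through
    the fundamental pair, so solutions are determined by their data at [0]. *)
Lemma solution_repr (a c dc s ds u v : R -> R) :
  solves a c dc -> solves a s ds -> solves a u v ->
  c 0 = 1 -> dc 0 = 0 -> s 0 = 0 -> ds 0 = 1 ->
  forall t, u t = u 0 * c t + v 0 * s t.
Proof.
intros hc hs hu c0 dc0 s0 ds0 t.
pose proof (wronskian_const _ _ _ _ _ hc hs t) as W1.
pose proof (wronskian_const _ _ _ _ _ hu hs t) as W2.
pose proof (wronskian_const _ _ _ _ _ hu hc t) as W3.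
rewrite c0, dc0, s0, ds0 in *.
replace (u 0) with (u t * ds t - v t * s t) by lra.
replace (v 0) with (v t * c t - u t * dc t) by lra.
replace (u t) with (u t * (c t * ds t - dc t * s t)) at 1 by (rewrite W1; ring).
ring.
Qed.

(** Gronwall's argument for the energy [u^2 + v^2]: its derivative is at most
    [(2 + K)] times itself plus [g^2], by Young's inequality. *)
Lemma energy_bound (a g u v : R -> R) (T K G : R) :
  0 <= K -> 0 <= G ->
  (forall t, 0 <= t <= T -> Rabs (a t) <= K) ->
  (forall t, 0 <= t <= T -> g t ^ 2 <= G) ->
  (forall t, is_derive u t (v t)) -> (forall t, is_derive v t (a t * u t + g t)) ->
  forall t, 0 <= t <= T ->
    u t ^ 2 + v t ^ 2 <= (u 0 ^ 2 + v 0 ^ 2 + G * t) * exp ((2 + K) * t).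
Proof.
intros hK hG ha hg hu hv t ht.
pose (w := fun s => exp (- ((2 + K) * s))).
pose (dh := fun s =>
  G - (2 * u s * v s + 2 * v s * (a s * u s + g s)
       - (2 + K) * (u s ^ 2 + v s ^ 2)) * w s).
assert (H : G * 0 - (u 0 ^ 2 + v 0 ^ 2) * w 0 <= G * t - (u t ^ 2 + v t ^ 2) * w t).
{ apply (incr_of_derive (fun s => G * s - (u s ^ 2 + v s ^ 2) * w s) dh); [lra| |].
  - intros s _. pose proof (hu s) as D1. pose proof (hv s) as D2. unfold dh, w.
    known_derive. ring.
  - intros s hs. unfold dh. specialize (ha s ltac:(lra)). specialize (hg s ltac:(lra)).
    assert (W : 0 < w s) by apply exp_pos.
    assert (W1 : w s <= 1).
    { unfold w. rewrite <- exp_0.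
      assert (0 <= (2 + K) * s) by (apply Rmult_le_pos; lra).
      destruct (Req_dec ((2 + K) * s) 0) as [E|E].
      - rewrite E, Ropp_0. lra.
      - left. apply exp_increasing. lra. }
    assert (A : 2 * (a s * (u s * v s)) <= K * (u s ^ 2 + v s ^ 2)).
    { apply Rabs_le_between in ha.
      pose proof (pow2_ge_0 (u s - v s)). pose proof (pow2_ge_0 (u s + v s)).
      nra. }
    assert (E : 2 * u s * v s + 2 * v s * (a s * u s + g s)
                - (2 + K) * (u s ^ 2 + v s ^ 2) <= G).
    { pose proof (pow2_ge_0 (u s - v s)). pose proof (pow2_ge_0 (v s - g s)). nra. }
    nra. }
unfold w in H. rewrite !Rmult_0_r, Ropp_0, exp_0 in H.
rewrite exp_Ropp in H. pose proof (exp_pos ((2 + K) * t)) as P.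
apply (Rmult_le_compat_r (exp ((2 + K) * t))) in H; [|lra].
replace (u t ^ 2 + v t ^ 2)
  with ((u t ^ 2 + v t ^ 2) * / exp ((2 + K) * t) * exp ((2 + K) * t)) by (field; lra).
lra.
Qed.

(** The coefficient of Hill's equation [u'' = (mu - f) u]. *)
Definition hill (f : R -> R) (mu t : R) : R := mu - f t.

Section Dependence.

Variables (f : R -> R) (F : R).
Hypothesis f_cont : forall t, continuous f t.
Hypothesis f_bound : forall t, Rabs (f t) <= F.

Local Notation q := (hill f).

Lemma hill_continuous (mu t : R) : continuous (q mu) t.
Proof. apply cont_minus; [apply continuous_const | apply f_cont]. Qed.

Lemma hill_bound (mu t : R) : Rabs (q mu t) <= Rabs mu + F.
Proof.
unfold hill, Rminus. apply Rle_trans with (1 := Rabs_triang _ _).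
rewrite Rabs_Ropp. specialize (f_bound t). lra.
Qed.

Lemma hill_sol_solves (mu alpha beta : R) :
  solves (q mu) (sol (q mu) alpha beta) (dsol (q mu) alpha beta).
Proof. apply sol_solves with (Rabs mu + F); auto using hill_continuous, hill_bound. Qed.

(** The difference of the solutions for [nu] and [mu] solves the equation for
    [mu] with zero data and forcing [(nu - mu) u_nu], so two energy estimates
    are enough. *)
Lemma sol_lipschitz (T mu alpha beta : R) :
  0 <= T -> exists M, 0 < M /\ forall nu, Rabs (nu - mu) <= 1 ->
    forall t, 0 <= t <= T ->
      Rabs (sol (q nu) alpha beta t - sol (q mu) alpha beta t) <= M * Rabs (nu - mu) /\
      Rabs (dsol (q nu) alpha beta t - dsol (q mu) alpha beta t) <= M * Rabs (nu - mu).
Proof.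
intros hT. pose proof (bound_nonneg f F f_bound) as hF. pose proof (Rabs_pos mu) as hmu.
set (K := Rabs mu + F). assert (K0 : 0 <= K) by (unfold K; lra).
set (A := (alpha ^ 2 + beta ^ 2) * exp ((2 + (K + 1)) * T)).
set (B := A * T * exp ((2 + K) * T)).
assert (EM : forall c t, 0 <= c -> 0 <= t <= T -> exp (c * t) <= exp (c * T)).
{ intros c t hc ht. assert (L : c * t <= c * T) by (apply Rmult_le_compat_l; lra).
  destruct L as [L| ->]; [left; now apply exp_increasing|lra]. }
assert (A0 : 0 <= A).
{ apply Rmult_le_pos; [|left; apply exp_pos].
  pose proof (pow2_ge_0 alpha). pose proof (pow2_ge_0 beta). lra. }
assert (B0 : 0 <= B).
{ apply Rmult_le_pos; [|left; apply exp_pos]. now apply Rmult_le_pos. }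
exists (1 + B). split; [lra|]. intros nu hnu t ht.
assert (HA : forall s, 0 <= s <= T -> sol (q nu) alpha beta s ^ 2 <= A).
{ intros s hs.
  pose proof (energy_bound (q nu) (fun _ => 0) (sol (q nu) alpha beta)
    (dsol (q nu) alpha beta) T (K + 1) 0) as H.
  specialize (H ltac:(lra) ltac:(lra)).
  specialize (H ltac:(intros r _; apply Rle_trans with (1 := hill_bound nu r); unfold K;
    pose proof (Rabs_triang mu (nu - mu)) as X;
    replace (mu + (nu - mu)) with nu in X by ring; lra)).
  specialize (H ltac:(intros r _; simpl; lra)).
  specialize (H (fun r => proj1 (hill_sol_solves nu alpha beta r))).
  specialize (H ltac:(intros r; rewrite Rplus_0_r; apply (hill_sol_solves nu alpha beta r)) s hs).
  rewrite (sol_0 (q nu) (Rabs nu + F)), (dsol_0 (q nu)) in H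
    by (auto using hill_continuous, hill_bound).
  rewrite Rmult_0_l, Rplus_0_r in H.
  pose proof (pow2_ge_0 (dsol (q nu) alpha beta s)).
  apply Rle_trans with ((alpha ^ 2 + beta ^ 2) * exp ((2 + (K + 1)) * s)); [lra|].
  apply Rmult_le_compat_l; [|apply EM; lra].
  pose proof (pow2_ge_0 alpha). pose proof (pow2_ge_0 beta). lra. }
assert (H : (sol (q nu) alpha beta t - sol (q mu) alpha beta t) ^ 2
            + (dsol (q nu) alpha beta t - dsol (q mu) alpha beta t) ^ 2
            <= (nu - mu) ^ 2 * B).
{ pose proof (energy_bound (q mu) (fun s => (nu - mu) * sol (q nu) alpha beta s)
    (fun s => sol (q nu) alpha beta s - sol (q mu) alpha beta s)
    (fun s => dsol (q nu) alpha beta s - dsol (q mu) alpha beta s)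
    T K ((nu - mu) ^ 2 * A)) as H.
  assert (G0 : 0 <= (nu - mu) ^ 2 * A) by (apply Rmult_le_pos; auto using pow2_ge_0).
  specialize (H K0 G0 (fun r _ => hill_bound mu r)).
  specialize (H ltac:(intros r hr; cbv beta; rewrite Rpow_mult_distr; apply Rmult_le_compat_l;
    [apply pow2_ge_0 | now apply HA])).
  specialize (H ltac:(intros r; apply (is_derive_minus (sol (q nu) alpha beta)
    (sol (q mu) alpha beta)); apply hill_sol_solves)).
  assert (H' : forall r, is_derive
      (fun s => dsol (q nu) alpha beta s - dsol (q mu) alpha beta s) r
      (q mu r * (sol (q nu) alpha beta r - sol (q mu) alpha beta r)
       + (nu - mu) * sol (q nu) alpha beta r)).
  { intros r.
    destruct (hill_sol_solves nu alpha beta r) as [_ D1].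
    destruct (hill_sol_solves mu alpha beta r) as [_ D2].
    replace (_ + _) with (q nu r * sol (q nu) alpha beta r - q mu r * sol (q mu) alpha beta r)
      by (unfold hill; ring).
    now apply (is_derive_minus (dsol (q nu) alpha beta) (dsol (q mu) alpha beta)). }
  specialize (H H' t ht). cbv beta in H.
  rewrite !(sol_0 (q _) (Rabs _ + F)), !(dsol_0 (q _)) in H
    by (auto using hill_continuous, hill_bound).
  rewrite !Rminus_diag in H. apply Rle_trans with (1 := H).
  replace (0 ^ 2 + 0 ^ 2 + (nu - mu) ^ 2 * A * t) with ((nu - mu) ^ 2 * A * t) by ring.
  unfold B. rewrite <- !Rmult_assoc.
  apply Rmult_le_compat.
  - apply Rmult_le_pos; lra.
  - left. apply exp_pos.
  - apply Rmult_le_compat_l; lra.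
  - apply EM; lra. }
assert (Sq : forall x y, x ^ 2 + y ^ 2 <= (nu - mu) ^ 2 * B ->
               Rabs x <= (1 + B) * Rabs (nu - mu)).
{ intros x y h. rewrite <- (Rabs_pos_eq (1 + B)), <- Rabs_mult by lra.
  apply Rsqr_le_abs_0. unfold Rsqr.
  pose proof (pow2_ge_0 y). pose proof (pow2_ge_0 (nu - mu)). nra. }
split.
- exact (Sq _ _ H).
- rewrite Rplus_comm in H. exact (Sq _ _ H).
Qed.

End Dependence.

(** * The principal periodic eigenvalue of Hill's equation *)

Lemma sign_change (f : R -> R) (t l : R) :
  is_derive f t l -> f t = 0 -> 0 < l ->
  exists d, 0 < d /\ forall h, 0 < h < d -> f (t - h) < 0 < f (t + h).
Proof.
intros hd h0 hl. apply is_derive_Reals in hd.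
destruct (hd l hl) as [d Hd]. exists d. split; [apply cond_pos|]. intros h hh.
pose proof (Hd h ltac:(lra) ltac:(rewrite Rabs_pos_eq; lra)) as H1.
pose proof (Hd (- h) ltac:(lra) ltac:(rewrite Rabs_Ropp, Rabs_pos_eq; lra)) as H2.
rewrite h0, Rminus_0_r in H1, H2. apply Rabs_def2 in H1. apply Rabs_def2 in H2.
split.
- replace (f (t - h)) with (- (f (t + - h) / - h * h))
    by (unfold Rminus; field; lra).
  assert (0 < f (t + - h) / - h * h) by (apply Rmult_lt_0_compat; lra). lra.
- replace (f (t + h)) with (f (t + h) / h * h) by (field; lra).
  apply Rmult_lt_0_compat; lra.
Qed.

Section Hill.

Variables (T F : R) (f : R -> R).
Hypothesis T_pos : 0 < T.
Hypothesis f_cont : forall t, continuous f t.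
Hypothesis f_bound : forall t, Rabs (f t) <= F.
Hypothesis f_periodic : forall t, f (t + T) = f t.
Hypothesis f_mean : RInt f 0 T = 0.

Definition hillC (mu : R) : R -> R := sol (hill f mu) 1 0.
Definition hillC' (mu : R) : R -> R := dsol (hill f mu) 1 0.
Definition hillS (mu : R) : R -> R := sol (hill f mu) 0 1.
Definition hillS' (mu : R) : R -> R := dsol (hill f mu) 0 1.

Local Notation C := hillC.
Local Notation C' := hillC'.
Local Notation S := hillS.
Local Notation S' := hillS'.

Lemma hillC_solves (mu : R) : solves (hill f mu) (C mu) (C' mu).
Proof. now apply hill_sol_solves with F. Qed.

Lemma hillS_solves (mu : R) : solves (hill f mu) (S mu) (S' mu).
Proof. now apply hill_sol_solves with F. Qed.

Lemma hill_init (mu : R) : C mu 0 = 1 /\ C' mu 0 = 0 /\ S mu 0 = 0 /\ S' mu 0 = 1.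
Proof.
unfold hillC, hillC', hillS, hillS'.
repeat split; (apply sol_0 with (Rabs mu + F) || apply dsol_0);
  intros t; now (apply hill_continuous || apply hill_bound).
Qed.

Lemma hill_wronskian (mu t : R) : C mu t * S' mu t - C' mu t * S mu t = 1.
Proof.
rewrite (wronskian_const (hill f mu)); auto using hillC_solves, hillS_solves.
destruct (hill_init mu) as (-> & -> & -> & ->). ring.
Qed.

(** The trace of the monodromy matrix, known as the discriminant. *)
Definition trace (mu : R) : R := C mu T + S' mu T.

(** The Floquet multipliers are real and positive, and no nonzero solution vanishes at
    [0] and again within a period. This describes the half line of [mu] starting
    at the principal eigenvalue of [u'' + f u = mu u] with periodic conditions. *)
Definition supercritical (mu : R) : Prop :=
  2 <= trace mu /\ forall t, 0 < t <= T -> 0 < S mu t.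

(** For [Y = C - x S], the value of [- Y' / Y] at [T] is a Moebius function of its
    value [x] at [0]. Its derivative is [1 / Y(T)^2], and the fixed points solve a
    quadratic equation whose midpoint of roots is [tangency]. At the principal
    eigenvalue the graph touches the diagonal there. *)
Definition tangency (mu : R) : R := (C mu T - S' mu T) / (2 * S mu T).
Definition psi (mu t : R) : R := C mu t - tangency mu * S mu t.
Definition psi' (mu t : R) : R := C' mu t - tangency mu * S' mu t.

Lemma combination_solves (mu x : R) :
  solves (hill f mu) (fun t => C mu t - x * S mu t) (fun t => C' mu t - x * S' mu t).
Proof.
intros t. destruct (hillC_solves mu t) as [D1 D2], (hillS_solves mu t) as [D3 D4].
split; known_derive; ring.
Qed.

Lemma psi_0 (mu : R) : psi mu 0 = 1 /\ psi' mu 0 = - tangency mu.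
Proof. unfold psi, psi'. destruct (hill_init mu) as (-> & -> & -> & ->). split; ring. Qed.

Lemma psi_T (mu : R) : S mu T <> 0 -> psi mu T = trace mu / 2.
Proof. intros h. unfold psi, tangency, trace. field. auto. Qed.

(** The discriminant of the fixed point equation is [trace^2 - 4], the Wronskian
    being [1]; its sign compares [- psi' / psi] at both ends of the period. *)
Lemma psi'_T (mu : R) : S mu T <> 0 ->
  psi' mu T + tangency mu * psi mu T = (trace mu ^ 2 - 4) / (4 * S mu T).
Proof.
intros h. pose proof (hill_wronskian mu T) as W.
unfold psi, psi', tangency, trace.
replace (C' mu T) with ((C mu T * S' mu T - 1) / S mu T)
  by (rewrite <- W; field; auto).
field. auto.
Qed.

(** [psi / S] has the negative derivative [- 1 / S^2], so [psi] is positive as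
    soon as its last value is. *)
Lemma psi_pos (mu t : R) : supercritical mu -> 0 <= t <= T -> 0 < psi mu t.
Proof.
intros [htr hS] ht. destruct (Req_dec t 0) as [->|nt].
{ destruct (psi_0 mu) as [-> _]. lra. }
pose proof (hS T ltac:(lra)) as ST. pose proof (hS t ltac:(lra)) as St.
assert (H : - (psi mu t / S mu t) <= - (psi mu T / S mu T)).
{ apply (incr_of_derive (fun s => - (psi mu s / S mu s)) (fun s => / S mu s ^ 2)); [lra| |].
  - intros s hs. destruct (combination_solves mu (tangency mu) s) as [D1 _].
    fold (psi mu) in D1. destruct (hillS_solves mu s) as [D2 _].
    pose proof (hS s ltac:(lra)) as Ss.
    assert (W : psi mu s * S' mu s - psi' mu s * S mu s = 1).
    { unfold psi, psi'. rewrite <- (hill_wronskian mu s). ring. }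
    replace (/ S mu s ^ 2)
      with (- ((psi' mu s * S mu s - psi mu s * S' mu s) / S mu s ^ 2))
      by (replace (psi' mu s * S mu s - psi mu s * S' mu s) with (-1) by lra; field; lra).
    apply (is_derive_opp (fun s => psi mu s / S mu s)).
    apply (is_derive_div (psi mu) (S mu)); auto; try lra.
  - intros s hs. left. apply Rinv_0_lt_compat, pow_lt, hS. lra. }
rewrite psi_T in H by lra.
assert (0 < trace mu / 2 / S mu T) by (apply Rdiv_lt_0_compat; lra).
replace (psi mu t) with (psi mu t / S mu t * S mu t) by (field; lra).
apply Rmult_lt_0_compat; lra.
Qed.

(** Dually, a positive solution [y] forces [S > 0], since [(S / y)' = 1 / y^2]. *)
Lemma S_pos_of_positive (mu x : R) :
  (forall t, 0 <= t <= T -> 0 < C mu t - x * S mu t) ->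
  forall t, 0 < t <= T -> 0 < S mu t.
Proof.
intros hy t ht. set (y := fun t => C mu t - x * S mu t) in *.
assert (H : S mu 0 / y 0 < S mu t / y t).
{ apply (strict_incr_of_derive (fun s => S mu s / y s) (fun s => / y s ^ 2)); [lra| |].
  - intros s hs. destruct (combination_solves mu x s) as [D1 _].
    destruct (hillS_solves mu s) as [D2 _]. fold y in D1.
    pose proof (hy s ltac:(lra)) as ys. fold (y s) in ys.
    replace (/ y s ^ 2)
      with ((S' mu s * y s - S mu s * (C' mu s - x * S' mu s)) / y s ^ 2).
    + apply (is_derive_div (S mu) y); auto; lra.
    + replace (_ - _) with (C mu s * S' mu s - C' mu s * S mu s) by (unfold y; ring).
      rewrite hill_wronskian. field. lra.
  - intros s hs. apply Rinv_0_lt_compat, pow_lt. apply hy. lra. }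
destruct (hill_init mu) as (_ & _ & E & _). rewrite E in H.
pose proof (hy t ltac:(lra)) as yt. fold (y t) in yt.
replace (S mu t) with (S mu t / y t * y t) by (field; lra).
apply Rmult_lt_0_compat; lra.
Qed.

(** Integrating [p' = p^2 + f - mu] for [p = - psi' / psi], whose increment over
    a period is nonpositive while [f] has zero mean. *)
Lemma supercritical_nonneg (mu : R) : supercritical mu -> 0 <= mu.
Proof.
intros hg. pose proof hg as [htr hS]. pose proof (hS T ltac:(lra)) as ST.
assert (P : forall t, 0 <= t <= T -> 0 < psi mu t) by (intros; now apply psi_pos).
assert (H : - (psi' mu 0 / psi mu 0) - RInt f 0 0 + mu * 0
            <= - (psi' mu T / psi mu T) - RInt f 0 T + mu * T).
{ apply (incr_of_derive (fun s => - (psi' mu s / psi mu s) - RInt f 0 s + mu * s)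
           (fun s => (psi' mu s / psi mu s) ^ 2)); [lra| |].
  - intros s hs. specialize (P s hs).
    destruct (combination_solves mu (tangency mu) s) as [D1 D2].
    fold (psi mu) in D1. fold (psi' mu) in D2. fold (psi mu s) in D2.
    replace (_ ^ 2) with
      (- ((hill f mu s * psi mu s * psi mu s - psi' mu s * psi' mu s) / psi mu s ^ 2)
       - f s + mu * 1) by (unfold hill; field; lra).
    apply (is_derive_plus (fun s => - (psi' mu s / psi mu s) - RInt f 0 s)).
    + apply (is_derive_minus (fun s => - (psi' mu s / psi mu s))).
      * apply (is_derive_opp (fun s => psi' mu s / psi mu s)).
        apply (is_derive_div (psi' mu) (psi mu)); auto; lra.
      * now apply is_derive_primitive.
    + apply (is_derive_scal (fun s => s)). apply (is_derive_id (K := R_AbsRing)).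
  - intros s _. apply pow2_ge_0. }
rewrite RInt_at_0, f_mean in H. destruct (psi_0 mu) as [E1 E2]. rewrite E1, E2 in H.
pose proof (P T ltac:(lra)) as PT.
pose proof (psi'_T mu ltac:(lra)) as E.
assert (N : 0 <= (psi' mu T + tangency mu * psi mu T) / psi mu T).
{ apply Rdiv_le_0_compat; [|lra]. rewrite E. apply Rdiv_le_0_compat; nra. }
replace (_ / _) with (psi' mu T / psi mu T + tangency mu) in N by (field; lra).
apply Rmult_le_reg_r with T; lra.
Qed.

(** For [mu = F] the coefficient is nonnegative, so [C C'] increases from [0] and
    [C^2] from [1]. *)
Lemma supercritical_bound : supercritical F.
Proof.
assert (Q : forall t, 0 <= hill f F t).
{ intros t. unfold hill. specialize (f_bound t). apply Rabs_le_between in f_bound. lra. }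
destruct (hill_init F) as (C0 & C'0 & S0 & S'0).
assert (P : forall t, 0 <= t -> 0 <= C F t * C' F t).
{ intros t ht. replace 0 with (C F 0 * C' F 0) by (rewrite C'0; ring).
  apply (incr_of_derive (fun s => C F s * C' F s)
           (fun s => C' F s ^ 2 + hill f F s * C F s ^ 2)); auto.
  - intros s _. destruct (hillC_solves F s) as [D1 D2]. known_derive. ring.
  - intros s _. pose proof (pow2_ge_0 (C' F s)). pose proof (pow2_ge_0 (C F s)).
    specialize (Q s). nra. }
assert (C1 : forall t, 0 <= t -> 1 <= C F t ^ 2).
{ intros t ht. replace 1 with (C F 0 ^ 2) by (rewrite C0; ring).
  apply (incr_of_derive (fun s => C F s ^ 2) (fun s => 2 * (C F s * C' F s))); auto.
  - intros s _. destruct (hillC_solves F s) as [D1 D2]. known_derive. ring.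
  - intros s hs. specialize (P s ltac:(lra)). lra. }
assert (Cp : forall t, 0 <= t -> 1 <= C F t).
{ intros t ht. destruct (Rle_dec 1 (C F t)) as [h|h]; auto. exfalso.
  assert (neg : C F t < 0) by (specialize (C1 t ht); nra).
  assert (cc : continuity (C F)).
  { intros s. apply continuity_pt_filterlim. destruct (hillC_solves F s) as [D1 _].
    exact (is_derive_cont _ _ _ D1). }
  destruct (IVT_gen (C F) 0 t 0 cc) as [z [hz z0]].
  - rewrite C0, Rmin_right, Rmax_left by lra. lra.
  - rewrite Rmin_left in hz by lra. specialize (C1 z ltac:(lra)). rewrite z0 in C1. lra. }
assert (Sp : forall t, 0 < t <= T -> 0 < S F t).
{ apply (S_pos_of_positive F 0). intros t ht. specialize (Cp t ltac:(lra)). lra. }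
split; auto.
pose proof (hill_wronskian F T) as W. pose proof (Cp T ltac:(lra)).
pose proof (P T ltac:(lra)). pose proof (Sp T ltac:(lra)). unfold trace.
assert (0 <= C' F T) by nra.
assert (0 <= C' F T * S F T) by nra. nra.
Qed.

Lemma hill_lipschitz (mu : R) : exists M, 0 < M /\ forall nu, Rabs (nu - mu) <= 1 ->
  forall t, 0 <= t <= T ->
    Rabs (C nu t - C mu t) <= M * Rabs (nu - mu) /\
    Rabs (S nu t - S mu t) <= M * Rabs (nu - mu) /\
    Rabs (S' nu t - S' mu t) <= M * Rabs (nu - mu).
Proof.
destruct (sol_lipschitz f F f_cont f_bound T mu 1 0) as [M1 [P1 H1]]; [lra|].
destruct (sol_lipschitz f F f_cont f_bound T mu 0 1) as [M2 [P2 H2]]; [lra|].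
exists (M1 + M2). split; [lra|]. intros nu hnu t ht.
destruct (H1 nu hnu t ht) as [A _]. destruct (H2 nu hnu t ht) as [B D].
pose proof (Rabs_pos (nu - mu)).
unfold hillC, hillS, hillS'. repeat split; nra.
Qed.

Lemma hill_close (mu eps : R) : 0 < eps -> exists d, 0 < d /\ forall nu,
  Rabs (nu - mu) < d -> forall t, 0 <= t <= T ->
    Rabs (C nu t - C mu t) <= eps /\
    Rabs (S nu t - S mu t) <= eps /\
    Rabs (S' nu t - S' mu t) <= eps.
Proof.
intros he. destruct (hill_lipschitz mu) as [M [M0 H]].
exists (Rmin 1 (eps / M)). split.
{ apply Rmin_glb_lt; [lra|]. now apply Rdiv_lt_0_compat. }
intros nu hnu t ht.
pose proof (Rmin_l 1 (eps / M)). pose proof (Rmin_r 1 (eps / M)).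
assert (M * Rabs (nu - mu) <= eps).
{ replace eps with (M * (eps / M)) by (field; lra). apply Rmult_le_compat_l; lra. }
destruct (H nu ltac:(lra) t ht) as (A & B & D). repeat split; lra.
Qed.

(** In the limit [S >= 0] only; a zero of [S] inside would be a double zero, and a
    zero at [T] would make both [S' T] and [C T = 1 / S' T] negative. *)
Lemma supercritical_closed (mu : R) :
  (forall d, 0 < d -> exists nu, supercritical nu /\ Rabs (nu - mu) < d) -> supercritical mu.
Proof.
intros hl.
assert (htr : 2 <= trace mu).
{ apply Rnot_lt_le. intros hlt.
  destruct (hill_close mu ((2 - trace mu) / 3)) as [d [d0 H]]; [lra|].
  destruct (hl d d0) as [nu [[g _] hnu]].
  destruct (H nu hnu T ltac:(lra)) as (A & _ & B).
  apply Rabs_le_between in A. apply Rabs_le_between in B. unfold trace in *. lra. }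
assert (S0 : forall t, 0 <= t <= T -> 0 <= S mu t).
{ intros t ht. apply Rnot_lt_le. intros hlt.
  destruct (hill_close mu (- S mu t / 2)) as [d [d0 H]]; [lra|].
  destruct (hl d d0) as [nu [[_ g] hnu]].
  destruct (H nu hnu t ht) as (_ & A & _). apply Rabs_le_between in A.
  destruct (Req_dec t 0) as [->|nt].
  - destruct (hill_init mu) as (_ & _ & E & _). lra.
  - specialize (g t ltac:(lra)). lra. }
split; auto. intros t ht.
destruct (S0 t ltac:(lra)) as [h|h]; auto. exfalso. symmetry in h.
pose proof (hill_wronskian mu t) as W. rewrite h, Rmult_0_r, Rminus_0_r in W.
destruct (hillS_solves mu t) as [D _].
assert (neg : S' mu t < 0).
{ destruct (Rtotal_order (S' mu t) 0) as [A|[A|A]]; auto.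
  - rewrite A in W. lra.
  - destruct (sign_change _ _ _ D h A) as [d [d0 H]].
    destruct (H (Rmin (d / 2) t)) as [H1 _].
    { split; [apply Rmin_glb_lt; lra|]. pose proof (Rmin_l (d / 2) t). lra. }
    pose proof (Rmin_r (d / 2) t). assert (0 < Rmin (d / 2) t) by (apply Rmin_glb_lt; lra).
    specialize (S0 (t - Rmin (d / 2) t) ltac:(lra)). lra. }
destruct (Req_dec t T) as [->|nT].
- unfold trace in htr. nra.
- destruct (sign_change (fun s => - S mu s) t (- S' mu t)) as [d [d0 H]];
    [now apply (is_derive_opp (S mu)) | lra | lra |].
  destruct (H (Rmin (d / 2) (T - t))) as [_ H1].
  { split; [apply Rmin_glb_lt; lra|]. pose proof (Rmin_l (d / 2) (T - t)). lra. }
  pose proof (Rmin_r (d / 2) (T - t)).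
  assert (0 < Rmin (d / 2) (T - t)) by (apply Rmin_glb_lt; lra).
  specialize (S0 (t + Rmin (d / 2) (T - t)) ltac:(lra)). lra.
Qed.

(** [psi] stays positive under a small change of [mu], with [x] kept fixed, and
    this positivity carries the one of [S], which degenerates at [0]. *)
Lemma supercritical_open (mu : R) :
  supercritical mu -> 2 < trace mu -> exists nu, nu < mu /\ supercritical nu.
Proof.
intros hg htr. set (x := tangency mu).
destruct (continuity_ab_min (psi mu) 0 T) as [m [Hm Im]]; [lra| |].
{ intros s _. apply continuity_pt_filterlim.
  destruct (combination_solves mu (tangency mu) s) as [D _].
  exact (is_derive_cont _ _ _ D). }
pose proof (psi_pos mu m hg Im) as Pm.
pose proof (Rabs_pos x) as X0.
set (e := Rmin ((trace mu - 2) / 3) (psi mu m / (2 * (1 + Rabs x)))).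
assert (e1 : e <= (trace mu - 2) / 3) by apply Rmin_l.
assert (e2 : e * (1 + Rabs x) <= psi mu m / 2).
{ replace (psi mu m / 2) with (psi mu m / (2 * (1 + Rabs x)) * (1 + Rabs x))
    by (field; lra).
  apply Rmult_le_compat_r; [lra|apply Rmin_r]. }
assert (e0 : 0 < e).
{ apply Rmin_glb_lt; [lra|]. apply Rdiv_lt_0_compat; lra. }
destruct (hill_close mu e e0) as [d [d0 H]].
exists (mu - d / 2). split; [lra|].
assert (hnu : Rabs (mu - d / 2 - mu) < d).
{ replace (mu - d / 2 - mu) with (- (d / 2)) by ring.
  rewrite Rabs_Ropp, Rabs_pos_eq; lra. }
split.
- destruct (H _ hnu T ltac:(lra)) as (A & _ & B).
  apply Rabs_le_between in A. apply Rabs_le_between in B. unfold trace in *. lra.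
- apply (S_pos_of_positive _ x). intros t ht.
  destruct (H _ hnu t ht) as (A & B & _). specialize (Hm t ht).
  set (nu := mu - d / 2) in *.
  assert (E : Rabs ((C nu t - C mu t) - x * (S nu t - S mu t)) <= e * (1 + Rabs x)).
  { unfold Rminus at 1. apply Rle_trans with (1 := Rabs_triang _ _).
    rewrite Rabs_Ropp, Rabs_mult. pose proof (Rabs_pos (S nu t - S mu t)). nra. }
  apply Rabs_le_between in E.
  unfold psi in Hm at 2. fold x in Hm. lra.
Qed.

(** The infimum of the supercritical parameters is supercritical by closedness,
    and by openness its trace cannot exceed [2]. *)
Lemma principal_exists : exists mu, supercritical mu /\ trace mu = 2.
Proof.
destruct (completeness (fun y => supercritical (- y))) as [l [ub lub]].
- exists 0. intros y hy. apply supercritical_nonneg in hy. lra.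
- exists (- F). rewrite Ropp_involutive. apply supercritical_bound.
- assert (hg : supercritical (- l)).
  { apply supercritical_closed. intros d hd.
    destruct (Classical_Prop.classic (exists nu, supercritical nu /\ Rabs (nu - - l) < d))
      as [h|h]; auto. exfalso.
    assert (l <= l - d); [|lra]. apply lub. intros y hy.
    apply Rnot_lt_le. intros hlt. apply h. exists (- y). split; auto.
    specialize (ub y hy). rewrite Rabs_pos_eq; lra. }
  exists (- l). split; auto.
  destruct hg as [htr hS]. destruct htr as [htr|]; auto. exfalso.
  destruct (supercritical_open (- l)) as [nu [hlt hnu]]; [split; auto; lra|auto|].
  specialize (ub (- nu)). cbv beta in ub. rewrite Ropp_involutive in ub. specialize (ub hnu). lra.
Qed.

Lemma hill_shift (mu : R) (u v : R -> R) :
  solves (hill f mu) u v -> solves (hill f mu) (fun t => u (t + T)) (fun t => v (t + T)).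
Proof.
intros h t. destruct (h (t + T)) as [D1 D2].
assert (D : is_derive (fun t => t + T) t 1) by (auto_derive; [auto|ring]).
split.
- rewrite <- (Rmult_1_l (v (t + T))). apply (is_derive_comp u (fun t => t + T)); auto.
- rewrite <- (Rmult_1_l (hill f mu t * _)).
  apply (is_derive_comp v (fun t => t + T)); auto.
  replace (hill f mu t) with (hill f mu (t + T)) by (unfold hill; now rewrite f_periodic).
  exact D2.
Qed.

(** With trace [2] the data of [psi] at [T] and at [0] agree, and solutions are
    determined by their data. *)
Lemma psi_periodic (mu : R) : supercritical mu -> trace mu = 2 ->
  forall t, psi mu (t + T) = psi mu t.
Proof.
intros hg htr t. pose proof (proj2 hg T ltac:(lra)) as ST.
pose proof (solution_repr (hill f mu) (C mu) (C' mu) (S mu) (S' mu)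
  (fun t => psi mu (t + T)) (fun t => psi' mu (t + T))) as H.
destruct (hill_init mu) as (C0 & C'0 & S0 & S'0).
rewrite H; auto using hillC_solves, hillS_solves.
- rewrite Rplus_0_l. pose proof (psi_T mu ltac:(lra)) as E.
  pose proof (psi'_T mu ltac:(lra)) as E'.
  rewrite htr in E, E'. replace (psi mu T) with 1 in * by lra.
  replace (psi' mu T) with (- tangency mu) by
    (replace (_ / _) with 0 in E' by (field; lra); lra).
  unfold psi. ring.
- apply hill_shift. apply combination_solves.
Qed.

End Hill.

(** * The principal solution of the Riccati equation *)

Lemma periodic_INR (g : R -> R) (T : R) :
  (forall t, g (t + T) = g t) -> forall n t, g (t + INR n * T) = g t.
Proof.
intros hg n t. induction n as [|n IH].
- simpl. now rewrite Rmult_0_l, Rplus_0_r.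
- rewrite S_INR. replace (t + (INR n + 1) * T) with (t + INR n * T + T) by ring.
  now rewrite hg.
Qed.

Lemma periodic_reduce (g : R -> R) (T : R) :
  0 < T -> (forall t, g (t + T) = g t) ->
  forall t, exists s, 0 <= s <= T /\ g s = g t.
Proof.
intros hT hg t.
destruct (base_Int_part (t / T)) as [A B]. set (z := Int_part (t / T)) in *.
assert (E : t / T * T = t) by (field; lra).
exists (t - IZR z * T). split; [split; nra|].
destruct (Z.le_gt_cases 0 z) as [h|h].
- rewrite <- (Z2Nat.id z h), <- INR_IZR_INZ.
  rewrite <- (periodic_INR g T hg (Z.to_nat z)). f_equal. ring.
- rewrite <- (periodic_INR g T hg (Z.to_nat (- z)) t). f_equal.
  rewrite INR_IZR_INZ, Z2Nat.id, opp_IZR by lia. ring.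
Qed.

Lemma bounded_on_segment (T : R) (g : R -> R) :
  0 <= T -> (forall t, continuous g t) ->
  exists B, 0 <= B /\ forall t, 0 <= t <= T -> Rabs (g t) <= B.
Proof.
intros hT hg.
destruct (max_on_attained T (fun t => Rabs (g t)) hT) as [[s [_ E]] H].
- intros t. apply (continuous_comp g Rabs); [apply hg|apply continuous_Rabs].
- exists (max_on T (fun t => Rabs (g t))). split.
  + rewrite E. apply Rabs_pos.
  + intros t ht. apply H. now exists t.
Qed.

Lemma periodic_bounded (T : R) (g : R -> R) :
  0 < T -> (forall t, continuous g t) -> (forall t, g (t + T) = g t) ->
  exists B, forall t, Rabs (g t) <= B.
Proof.
intros hT hc hp. destruct (bounded_on_segment T g) as [B [_ HB]]; [lra|auto|].
exists B. intros t. destruct (periodic_reduce g T hT hp t) as [s [hs <-]]. auto.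
Qed.

(** The Riccati form of the principal eigenvalue: [p] is minus the logarithmic
    derivative of the positive periodic eigenfunction [psi], hence is periodic
    and, [ln psi] being periodic too, has zero mean. *)
Theorem riccati_principal (T : R) (f : R -> R) :
  0 < T -> (forall t, continuous f t) -> (forall t, f (t + T) = f t) ->
  RInt f 0 T = 0 ->
  exists (mu : R) (p : R -> R),
    (forall t, is_derive p t (p t ^ 2 + f t - mu)) /\
    (forall t, p (t + T) = p t) /\ RInt p 0 T = 0.
Proof.
intros hT hc hp hm. destruct (periodic_bounded T f hT hc hp) as [F HF].
destruct (principal_exists T F f) as [mu [hg htr]]; auto.
set (y := psi T f mu). set (y' := psi' T f mu).
assert (D : forall t, is_derive y t (y' t) /\ is_derive y' t (hill f mu t * y t)).
{ apply (combination_solves F f hc HF). }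
assert (yT : forall t, y (t + T) = y t) by (now apply psi_periodic with F).
assert (ypos : forall t, 0 < y t).
{ intros t. destruct (periodic_reduce y T hT yT t) as [s [hs <-]].
  now apply (psi_pos T F f). }
assert (y'T : forall t, y' (t + T) = y' t).
{ intros t. rewrite <- (is_derive_unique _ _ _ (proj1 (D t))).
  apply eq_sym, is_derive_unique.
  apply (is_derive_ext (fun s => y (s + T))); [exact yT|].
  rewrite <- (Rmult_1_l (y' (t + T))).
  apply (is_derive_comp y (fun s => s + T)); [apply D|]. auto_derive; [auto|ring]. }
assert (Dp : forall t, is_derive (fun t => - (y' t / y t)) t
                         ((- (y' t / y t)) ^ 2 + f t - mu)).
{ intros t. specialize (ypos t). destruct (D t) as [D1 D2].
  replace (_ + f t - mu) with
    (- ((hill f mu t * y t * y t - y' t * y' t) / y t ^ 2)) by (unfold hill; field; lra).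
  apply (is_derive_opp (fun t => y' t / y t)).
  apply (is_derive_div y' y); auto. lra. }
exists mu, (fun t => - (y' t / y t)). split; [exact Dp|]. split.
- intros t. now rewrite yT, y'T.
- rewrite (RInt_is_derive (fun t => - ln (y t))).
  + rewrite <- (yT 0), Rplus_0_l. apply Rminus_diag.
  + intros t. specialize (ypos t).
    apply (is_derive_opp (fun t => ln (y t))).
    replace (y' t / y t) with (y' t * / y t) by reflexivity.
    apply (is_derive_comp ln y); [|apply D].
    apply is_derive_Reals. now apply derivable_pt_lim_ln.
  + intros t. exact (is_derive_cont _ _ _ (Dp t)).
Qed.

(** With [G] the primitive of [f], the function [p - G] is periodic and has the
    derivative [p^2]; being monotone and periodic it is constant, and [p = 0]. *)
Lemma riccati_zero (T : R) (f p : R -> R) :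
  0 < T -> (forall t, continuous f t) -> (forall t, f (t + T) = f t) ->
  RInt f 0 T = 0 ->
  (forall t, is_derive p t (p t ^ 2 + f t)) -> (forall t, p (t + T) = p t) ->
  forall t, f t = 0.
Proof.
intros hT hc hf hm hd hp.
set (G := fun t => RInt f 0 t).
assert (DG : forall t, is_derive G t (f t)) by (intros t; now apply is_derive_primitive).
assert (GT : forall t, G (t + T) = G t).
{ intros t.
  assert (K : G (t + T) - G t = G (0 + T) - G 0).
  { apply (const_of_derive (fun s => G (s + T) - G s)). intros s.
    replace 0 with (1 * f (s + T) - f s) by (rewrite hf; ring).
    apply (is_derive_minus (fun s => G (s + T))); [|apply DG].
    apply (is_derive_comp G (fun s => s + T)); [apply DG|].
    auto_derive; [auto|ring]. }
  unfold G in K at 3 4. rewrite Rplus_0_l, hm, RInt_at_0 in K. lra. }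
set (phi := fun t => p t - G t).
assert (Dphi : forall t, is_derive phi t (p t ^ 2)).
{ intros t. replace (p t ^ 2) with (p t ^ 2 + f t - f t) by ring.
  apply (is_derive_minus p G); auto. }
assert (incr : forall s t, s <= t -> phi s <= phi t).
{ intros s t hst. apply (incr_of_derive phi (fun t => p t ^ 2)); auto.
  intros r _. apply pow2_ge_0. }
assert (phiT : forall t, phi (t + T) = phi t).
{ intros t. unfold phi. now rewrite hp, GT. }
assert (K : forall t, phi 0 = phi t).
{ intros t. destruct (periodic_reduce phi T hT phiT t) as [s [hs <-]].
  apply Rle_antisym; [apply incr; lra|].
  rewrite <- (phiT 0), Rplus_0_l. apply incr; lra. }
assert (p0 : forall t, 0 = p t).
{ intros t.
  assert (E : p t ^ 2 = 0).
  { rewrite <- (is_derive_unique _ _ _ (Dphi t)). apply is_derive_unique.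
    apply (is_derive_ext (fun _ => phi 0)); auto.
    apply (is_derive_const (K := R_AbsRing) (V := R_NormedModule)). }
  symmetry. apply Rsqr_0_uniq. unfold Rsqr. lra. }
intros t. specialize (hd t). apply is_derive_unique in hd.
rewrite <- p0 in hd.
assert (E : Derive p t = 0).
{ apply is_derive_unique. apply (is_derive_ext (fun _ => 0)); auto.
  apply (is_derive_const (K := R_AbsRing) (V := R_NormedModule)). }
change (R_AbsRing -> R) with (R -> R) in *. rewrite E in hd. lra.
Qed.

(** * The functionals *)

Lemma hat_continuous (T : R) (g : R -> R) (t : R) :
  continuous g t -> continuous (hat T g) t.
Proof. intros h. apply cont_minus; [auto|apply continuous_const]. Qed.

Lemma hat_mean (T : R) (g : R -> R) :
  0 < T -> (forall t, continuous g t) -> RInt (hat T g) 0 T = 0.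
Proof.
intros hT hg. unfold hat, average.
rewrite (RInt_minus (V := R_CompleteNormedModule) g (fun _ => / T * RInt g 0 T)).
- rewrite (RInt_const (V := R_CompleteNormedModule)).
  unfold minus, plus, opp, scal; simpl; unfold mult; simpl. field. lra.
- now apply cont_ex_RInt.
- apply cont_ex_RInt. intros t. apply continuous_const.
Qed.

Lemma weight_is_derive (q : R -> R) (t : R) :
  (forall s, continuous q s) -> is_derive (weight q) t (- 2 * q t * weight q t).
Proof.
intros hq. unfold weight.
apply (is_derive_comp exp (fun s => - 2 * RInt q 0 s)).
- apply is_derive_Reals, derivable_pt_lim_exp.
- apply (is_derive_scal (fun s => RInt q 0 s)). now apply is_derive_primitive.
Qed.

Lemma weight_continuous (q : R -> R) (t : R) :
  (forall s, continuous q s) -> continuous (weight q) t.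
Proof. intros hq. exact (is_derive_cont _ _ _ (weight_is_derive q t hq)). Qed.

Lemma weight_RInt_pos (T : R) (q : R -> R) :
  0 < T -> (forall s, continuous q s) -> 0 < RInt (weight q) 0 T.
Proof.
intros hT hq. apply RInt_gt_0; auto.
- intros t _. apply exp_pos.
- intros t _. now apply weight_continuous.
Qed.

Lemma lower_integrand_continuous (T : R) (gamma p : C1per T) (t : R) :
  continuous (fun t : R => p t ^ 2 + hat T gamma t - Derive p t) t.
Proof.
apply cont_minus; [|apply C1per_continuous_Derive].
apply cont_plus; [apply cont_sqr|apply hat_continuous]; apply C1per_continuous.
Qed.

Lemma upper_integrand_continuous (T : R) (gamma q : C1per T) (t : R) :
  continuous (fun t => weight q t * (q t ^ 2 - hat T gamma t)) t.
Proof.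
apply cont_mult; [apply weight_continuous; apply C1per_continuous|].
apply cont_minus; [apply cont_sqr|apply hat_continuous]; apply C1per_continuous.
Qed.

(** The increment of [weight q * p] over a period vanishes because [q] has zero
    mean; this is the integration by parts linking the two functionals. *)
Lemma weight_by_parts (T : R) (p : C1per T) (q : C1per0 T) (m : R) :
  (forall t, continuous (fun t => weight q t * (m - Derive p t + 2 * q t * p t)) t) /\
  RInt (fun t => weight q t * (m - Derive p t + 2 * q t * p t)) 0 T
  = m * RInt (weight q) 0 T :> R.
Proof.
pose proof (C1per_continuous T q) as hq.
pose proof (C1per_continuous T p) as hp.
assert (hc : forall t,
  continuous (fun t => weight q t * (m - Derive p t + 2 * q t * p t)) t).
{ intros t. apply cont_mult; [now apply weight_continuous|]. apply cont_plus.
  - apply cont_minus; [apply continuous_const|apply C1per_continuous_Derive].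
  - apply cont_mult; auto. apply cont_mult; auto. apply continuous_const. }
split; auto.
rewrite (RInt_is_derive (fun t => m * RInt (weight q) 0 t - weight q t * p t)); auto.
- assert (E0 : weight q 0 = 1).
  { unfold weight. rewrite RInt_at_0, Rmult_0_r. apply exp_0. }
  assert (ET : weight q T = 1).
  { unfold weight. rewrite C1per0_zero_average, Rmult_0_r. apply exp_0. }
  rewrite RInt_at_0, E0, ET. rewrite <- (C1per_periodic T p 0), Rplus_0_l. ring.
- intros t.
  replace (weight q t * _) with
    (m * weight q t - (- 2 * q t * weight q t * p t + weight q t * Derive p t)) by ring.
  apply (is_derive_minus (fun t => m * RInt (weight q) 0 t)).
  + apply (is_derive_scal (fun t => RInt (weight q) 0 t)). apply is_derive_primitive.
    intros s. now apply weight_continuous.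
  + apply (is_derive_mult (weight q) p); [now apply weight_is_derive| |exact Rmult_comm].
    apply Derive_correct, C1per_ex_derive.
Qed.

(** With [m] the lower functional at [p], the definition of [m] gives
    [q^2 - hat gamma >= m - p' + 2 q p + (q - p)^2] pointwise; drop the square
    and integrate against the weight. *)
Lemma lower_le_upper (T : R) (gamma p : C1per T) (q : C1per0 T) :
  0 < T -> mu_lower T gamma p <= mu_upper T gamma q.
Proof.
intros hT. set (m := mu_lower T gamma p).
pose proof (weight_RInt_pos T q hT (C1per_continuous T q)) as W.
destruct (weight_by_parts T p q m) as [hc E].
assert (H : m * RInt (weight q) 0 T
            <= RInt (fun t => weight q t * (q t ^ 2 - hat T gamma t)) 0 T).
{ rewrite <- E. apply RInt_le; [lra|now apply cont_ex_RInt| |].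
  - apply cont_ex_RInt. apply upper_integrand_continuous.
  - intros t ht. apply Rmult_le_compat_l; [left; apply exp_pos|].
    destruct (max_on_attained T _ (Rlt_le _ _ hT) (lower_integrand_continuous T gamma p))
      as [_ H].
    assert (It : 0 <= t <= T) by lra.
    specialize (H _ (ex_intro _ t (conj It eq_refl))). cbv beta in H.
    unfold m, mu_lower. pose proof (pow2_ge_0 (q t - p t)). lra. }
unfold mu_upper. apply Rmult_le_reg_l with (RInt (weight q) 0 T); auto.
rewrite <- Rmult_assoc, Rinv_r by lra. lra.
Qed.

Lemma upper_zero (T : R) (gamma : C1per T) :
  0 < T -> mu_upper T gamma (C1per0_zero T) = 0.
Proof.
intros hT. unfold mu_upper.
replace (RInt (fun t => _ * _) 0 T) with 0; [ring|].
rewrite (RInt_ext (V := R_CompleteNormedModule) _ (fun t => opp (hat T gamma t))).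
- rewrite (RInt_opp (V := R_CompleteNormedModule)).
  + rewrite hat_mean by (auto using C1per_continuous). unfold opp; simpl. ring.
  + apply cont_ex_RInt. intros t. apply hat_continuous, C1per_continuous.
- intros t _. unfold weight. simpl.
  rewrite (RInt_const (V := R_CompleteNormedModule)).
  unfold scal, opp; simpl; unfold mult; simpl.
  rewrite !Rmult_0_r, exp_0. ring.
Qed.

Lemma max_on_constant (T m : R) (g : R -> R) :
  0 < T -> (forall t, g t = m) -> max_on T g = m.
Proof.
intros hT hg. rewrite (max_on_ext T g (fun _ => m) hg).
destruct (max_on_attained T (fun _ => m) (Rlt_le _ _ hT)) as [[s [_ E]] _]; auto.
intros t. apply continuous_const.
Qed.

(** Along the Riccati equation the maximum is that of a constant, and no square is
    lost in the comparison of the two functionals since [q = p]. *)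
Lemma riccati_optimal (T mu : R) (gamma : C1per T) (p : C1per0 T) :
  0 < T -> (forall t, Derive p t = p t ^ 2 + hat T gamma t - mu) ->
  mu_lower T gamma p = - mu /\ mu_upper T gamma p = - mu.
Proof.
intros hT hp. split.
- unfold mu_lower. f_equal. apply max_on_constant; auto.
  intros t. rewrite hp. ring.
- pose proof (weight_RInt_pos T p hT (C1per_continuous T p)) as W.
  destruct (weight_by_parts T p p (- mu)) as [_ E].
  unfold mu_upper. apply Rmult_eq_reg_l with (RInt (weight p) 0 T); [|lra].
  rewrite <- Rmult_assoc, Rinv_r, Rmult_1_l, (Rmult_comm _ (- mu)), <- E by lra.
  apply (RInt_ext (V := R_CompleteNormedModule)). intros t _. simpl. rewrite hp. ring.
Qed.

(** * Continuity of the functionals *)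

Lemma C1_ball_pointwise (T : R) (p q : C1per T) (e : R) :
  0 < T -> C1_ball T p e q ->
  forall t, 0 <= t <= T -> Rabs (q t - p t) < e /\
    Rabs (q t - p t) + Rabs (Derive q t - Derive p t) < e.
Proof.
intros hT hb t ht. unfold C1_ball in hb. rewrite C1_norm_minus in hb.
destruct (max_on_attained T (fun t => Rabs (p t - q t)) (Rlt_le _ _ hT)) as [_ H1].
{ intros s. apply continuous_Rabs_minus; apply C1per_continuous. }
destruct (max_on_attained T (fun t => Rabs (Derive p t - Derive q t)) (Rlt_le _ _ hT))
  as [_ H2].
{ intros s. apply continuous_Rabs_minus; apply C1per_continuous_Derive. }
specialize (H1 _ (ex_intro _ t (conj ht eq_refl))). cbv beta in H1.
specialize (H2 _ (ex_intro _ t (conj ht eq_refl))). cbv beta in H2.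
rewrite (Rabs_minus_sym (q t)), (Rabs_minus_sym (Derive q t)).
pose proof (Rabs_pos (p t - q t)). pose proof (Rabs_pos (Derive p t - Derive q t)).
lra.
Qed.

Definition unif_at {U : UniformSpace} (T : R) (F : U -> R -> R) (x : U) : Prop :=
  forall eps, 0 < eps ->
    locally x (fun y => forall t, 0 <= t <= T -> Rabs (F y t - F x t) < eps).

Section Uniform.

Context {U : UniformSpace}.
Variables (T : R) (x : U).
Hypothesis T_pos : 0 < T.

Lemma unif_const (g : R -> R) : unif_at T (fun _ : U => g) x.
Proof.
intros eps he. apply filter_forall. intros y t _.
now rewrite Rminus_diag, Rabs_R0.
Qed.

Lemma unif_minus (F G : U -> R -> R) :
  unif_at T F x -> unif_at T G x -> unif_at T (fun y t => F y t - G y t) x.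
Proof.
intros hF hG eps he.
generalize (filter_and (F := locally x) _ _ (hF (eps / 2) ltac:(lra)) (hG (eps / 2) ltac:(lra))).
apply filter_imp. intros y [H1 H2] t ht. specialize (H1 t ht). specialize (H2 t ht).
apply Rabs_def2 in H1. apply Rabs_def2 in H2. apply Rabs_def1; lra.
Qed.

Lemma unif_mult (F G : U -> R -> R) :
  (forall t, continuous (F x) t) -> (forall t, continuous (G x) t) ->
  unif_at T F x -> unif_at T G x -> unif_at T (fun y t => F y t * G y t) x.
Proof.
intros cF cG hF hG eps he.
destruct (bounded_on_segment T _ (Rlt_le _ _ T_pos) cF) as [A [A0 HA]].
destruct (bounded_on_segment T _ (Rlt_le _ _ T_pos) cG) as [B [B0 HB]].
set (d := Rmin 1 (eps / (A + B + 2))).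
assert (d0 : 0 < d).
{ apply Rmin_glb_lt; [lra|]. apply Rdiv_lt_0_compat; lra. }
assert (d1 : d <= 1) by apply Rmin_l.
assert (d2 : d * (A + B + 1) < eps).
{ assert (d * (A + B + 2) <= eps).
  { replace eps with (eps / (A + B + 2) * (A + B + 2)) by (field; lra).
    apply Rmult_le_compat_r; [lra|apply Rmin_r]. }
  nra. }
generalize (filter_and (F := locally x) _ _ (hF d d0) (hG d d0)).
apply filter_imp. intros y [H1 H2] t ht. specialize (H1 t ht). specialize (H2 t ht).
specialize (HA t ht). specialize (HB t ht).
replace (_ - _) with ((F y t - F x t) * (G y t - G x t)
  + ((F y t - F x t) * G x t + F x t * (G y t - G x t))) by ring.
apply Rle_lt_trans with (2 := d2).
apply Rle_trans with (1 := Rabs_triang _ _).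
pose proof (Rabs_triang ((F y t - F x t) * G x t) (F x t * (G y t - G x t))) as H.
rewrite !Rabs_mult in *.
pose proof (Rabs_pos (F y t - F x t)). pose proof (Rabs_pos (G y t - G x t)).
pose proof (Rabs_pos (F x t)). pose proof (Rabs_pos (G x t)).
assert (Rabs (F y t - F x t) * Rabs (G y t - G x t) <= d * 1)
  by (apply Rmult_le_compat; lra).
assert (Rabs (F y t - F x t) * Rabs (G x t) <= d * B)
  by (apply Rmult_le_compat; lra).
assert (Rabs (F x t) * Rabs (G y t - G x t) <= A * d)
  by (apply Rmult_le_compat; lra).
lra.
Qed.

(** [exp (a + h) - exp a = exp a (exp h - 1)], and [exp a] is bounded. *)
Lemma unif_exp (F : U -> R -> R) :
  (forall t, continuous (F x) t) ->
  unif_at T F x -> unif_at T (fun y t => exp (F y t)) x.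
Proof.
intros cF hF eps he.
destruct (bounded_on_segment T _ (Rlt_le _ _ T_pos) cF) as [A [A0 HA]].
pose proof (exp_pos A) as EA.
destruct (proj1 (filterlim_locally exp (exp 0)) (continuous_exp 0)
  (mkposreal (eps / exp A) (Rdiv_lt_0_compat _ _ he EA))) as [d Hd].
generalize (hF d (cond_pos d)). apply filter_imp. intros y H t ht.
specialize (H t ht). specialize (HA t ht). apply Rabs_le_between in HA.
assert (Hb : Rabs (exp (F y t - F x t) - exp 0) < eps / exp A).
{ apply Hd. unfold ball; simpl; unfold AbsRing_ball, abs, minus, plus, opp; simpl.
  now rewrite Ropp_0, Rplus_0_r. }
rewrite exp_0 in Hb.
replace (exp (F y t)) with (exp (F x t) * exp (F y t - F x t))
  by (rewrite <- exp_plus; f_equal; ring).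
replace (_ - _) with (exp (F x t) * (exp (F y t - F x t) - 1)) by ring.
rewrite Rabs_mult, (Rabs_pos_eq (exp (F x t))) by (left; apply exp_pos).
assert (exp (F x t) <= exp A).
{ destruct (proj2 HA) as [h| ->]; [left; now apply exp_increasing|lra]. }
apply Rle_lt_trans with (exp A * Rabs (exp (F y t - F x t) - 1)).
- apply Rmult_le_compat_r; auto using Rabs_pos.
- replace eps with (exp A * (eps / exp A)) by (field; lra).
  now apply Rmult_lt_compat_l.
Qed.

Lemma unif_RInt (F : U -> R -> R) :
  (forall y t, continuous (F y) t) ->
  unif_at T F x -> unif_at T (fun y t => RInt (F y) 0 t) x.
Proof.
intros cF hF eps he.
generalize (hF (eps / (2 * T)) ltac:(apply Rdiv_lt_0_compat; lra)).
apply filter_imp. intros y H t ht.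
rewrite <- (RInt_minus (V := R_CompleteNormedModule)) by (now apply cont_ex_RInt).
apply Rle_lt_trans with ((t - 0) * (eps / (2 * T))).
- apply abs_RInt_le_const; [lra| |].
  + apply cont_ex_RInt. intros s. now apply (continuous_minus (F y) (F x)).
  + intros s hs. left. apply H. lra.
- assert (e0 : 0 < eps / (2 * T)) by (apply Rdiv_lt_0_compat; lra).
  assert (E : T * (eps / (2 * T)) = eps / 2) by (field; lra). nra.
Qed.

Lemma unif_continuous (F : U -> R -> R) (t : R) :
  0 <= t <= T -> unif_at T F x -> continuous (fun y => F y t) x.
Proof.
intros ht hF. apply filterlim_locally. intros eps.
generalize (hF eps (cond_pos eps)). apply filter_imp. intros y H. now apply H.
Qed.

End Uniform.

Lemma unif_eval (T : R) (q : C1per0 T) :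
  0 < T -> unif_at T (fun (r : C1per0 T) t => r t) q.
Proof.
intros hT eps he. exists (mkposreal eps he). intros r hr t ht.
exact (proj1 (C1_ball_pointwise T q r eps hT hr t ht)).
Qed.

Lemma mu_upper_continuous (T : R) (gamma : C1per T) (q : C1per0 T) :
  0 < T -> continuous (mu_upper T gamma) q.
Proof.
intros hT. pose proof (unif_eval T q hT) as hid.
assert (cw : forall (r : C1per0 T) t, continuous (weight r) t).
{ intros r t. apply weight_continuous, C1per_continuous. }
assert (hw : unif_at T (fun (r : C1per0 T) => weight r) q).
{ unfold weight. apply unif_exp; auto.
  - intros t. apply cont_mult; [apply continuous_const|].
    apply primitive_continuous, C1per_continuous.
  - apply (unif_mult T q hT (fun _ _ => - 2) (fun r t => RInt r 0 t)).
    + intros t. apply continuous_const.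
    + intros t. apply primitive_continuous, C1per_continuous.
    + apply unif_const.
    + apply unif_RInt; auto. intros r t. apply C1per_continuous. }
assert (hn : unif_at T
  (fun (r : C1per0 T) t => weight r t * (r t ^ 2 - hat T gamma t)) q).
{ apply unif_mult; auto.
  - intros t. apply cont_minus; [apply cont_sqr|apply hat_continuous];
      apply C1per_continuous.
  - apply (unif_minus T q (fun r t => r t ^ 2) (fun _ => hat T gamma)); [|apply unif_const].
    assert (h2 : unif_at T (fun (r : C1per0 T) t => r t * r t) q).
    { apply (unif_mult T q hT (fun r t => r t) (fun r t => r t)); auto;
        intros t; apply C1per_continuous. }
    intros eps he. generalize (h2 eps he). apply filter_imp. intros r H t ht.
    replace (r t ^ 2 - q t ^ 2) with (r t * r t - q t * q t) by ring. auto. }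
apply (continuous_mult (K := R_AbsRing) (fun r : C1per0 T => / RInt (weight r) 0 T)).
- apply (continuous_comp (fun r : C1per0 T => RInt (weight r) 0 T) Rinv).
  + apply (unif_continuous T q (fun (r : C1per0 T) t => RInt (weight r) 0 t)); [lra|].
    now apply unif_RInt.
  + apply continuous_Rinv.
    pose proof (weight_RInt_pos T q hT (C1per_continuous T q)). lra.
- apply (unif_continuous T q (fun (r : C1per0 T) t =>
    RInt (fun t => weight r t * (r t ^ 2 - hat T gamma t)) 0 t)); [lra|].
  apply (unif_RInt T q hT
    (fun (r : C1per0 T) t => weight r t * (r t ^ 2 - hat T gamma t))); auto.
  intros r t. apply upper_integrand_continuous.
Qed.

Lemma max_on_close (T e : R) (g h : R -> R) :
  0 < T -> (forall t, continuous g t) -> (forall t, continuous h t) ->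
  (forall t, 0 <= t <= T -> Rabs (g t - h t) < e) ->
  Rabs (max_on T g - max_on T h) < e.
Proof.
intros hT hg hh he.
destruct (max_on_attained T g (Rlt_le _ _ hT) hg) as [[s [hs Es]] Mg].
destruct (max_on_attained T h (Rlt_le _ _ hT) hh) as [[r [hr Er]] Mh].
pose proof (Mg _ (ex_intro _ r (conj hr eq_refl))) as H1.
pose proof (Mh _ (ex_intro _ s (conj hs eq_refl))) as H2. cbv beta in H1, H2.
pose proof (Rabs_def2 _ _ (he s hs)). pose proof (Rabs_def2 _ _ (he r hr)).
apply Rabs_def1; lra.
Qed.

Lemma mu_lower_continuous (T : R) (gamma p : C1per T) :
  0 < T -> continuous (mu_lower T gamma) p.
Proof.
intros hT. apply filterlim_locally. intros eps. pose proof (cond_pos eps) as he.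
destruct (bounded_on_segment T p (Rlt_le _ _ hT) (C1per_continuous T p)) as [B [B0 HB]].
set (d := Rmin 1 (eps / (2 * B + 2))).
assert (d0 : 0 < d).
{ apply Rmin_glb_lt; [lra|]. apply Rdiv_lt_0_compat; lra. }
assert (d1 : d <= 1) by apply Rmin_l.
assert (d2 : d * (2 * B + 2) <= eps).
{ replace (pos eps) with (eps / (2 * B + 2) * (2 * B + 2)) at 1 by (field; lra).
  apply Rmult_le_compat_r; [lra|apply Rmin_r]. }
exists (mkposreal d d0). intros q hq.
unfold ball; simpl; unfold AbsRing_ball, abs, minus, plus, opp, mu_lower; simpl.
rewrite Ropp_involutive, Rplus_comm.
change (Rabs (max_on T (fun t => p t ^ 2 + hat T gamma t - Derive p t)
  - max_on T (fun t => q t ^ 2 + hat T gamma t - Derive q t)) < eps).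
rewrite Rabs_minus_sym.
apply max_on_close; auto using lower_integrand_continuous.
intros t ht. destruct (C1_ball_pointwise T p q d hT hq t ht) as [H1 H2].
specialize (HB t ht). apply Rlt_le_trans with (2 := d2).
replace (_ - _) with ((q t - p t) * ((q t - p t) + 2 * p t) + - (Derive q t - Derive p t))
  by ring.
apply Rle_lt_trans with (1 := Rabs_triang _ _). rewrite Rabs_Ropp, Rabs_mult.
pose proof (Rabs_triang (q t - p t) (2 * p t)) as H3.
rewrite (Rabs_mult 2), (Rabs_pos_eq 2) in H3 by lra.
pose proof (Rabs_pos (q t - p t)). pose proof (Rabs_pos (Derive q t - Derive p t)).
assert (Rabs (q t - p t) * Rabs (q t - p t + 2 * p t)
        <= Rabs (q t - p t) * (1 + 2 * B)) by (apply Rmult_le_compat_l; lra).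
nra.
Qed.

(** * Existence of a common optimiser *)

Lemma optimiser_exists (T : R) (gamma : C1per T) :
  0 < T -> exists (mu : R) (p : C1per0 T),
    forall t, Derive p t = p t ^ 2 + hat T gamma t - mu.
Proof.
intros hT.
assert (fc : forall t, continuous (hat T gamma) t).
{ intros t. apply hat_continuous, C1per_continuous. }
destruct (riccati_principal T (hat T gamma)) as [mu [p [Dp [pT pm]]]]; auto.
- intros t. unfold hat. now rewrite C1per_periodic.
- apply hat_mean; auto. apply C1per_continuous.
- assert (E : forall t, Derive p t = p t ^ 2 + hat T gamma t - mu).
  { intros t. apply is_derive_unique, Dp. }
  assert (cD : forall t, continuous (Derive p) t).
  { intros t. apply (continuous_ext (fun t => p t ^ 2 + hat T gamma t - mu)).
    - intros s. now rewrite E.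
    - apply cont_minus; [|apply continuous_const].
      apply cont_plus; [|apply fc]. apply cont_sqr.
      exact (is_derive_cont _ _ _ (Dp t)). }
  exists mu, (MkC1per0 T (MkC1per T p (fun t => ex_intro _ _ (Dp t)) cD pT) pm).
  exact E.
Qed.

Theorem proposition1 (T : R) (gamma : C1per T) (hT : 0 < T) :
  (forall p : C1per T, continuous (mu_lower T gamma) p) /\
  (forall q : C1per0 T, continuous (mu_upper T gamma) q) /\
  (forall (p : C1per T) (q : C1per0 T),
      mu_lower T gamma p <= mu_upper T gamma q /\ mu_lower T gamma p <= 0) /\
  (exists (pstar : C1per0 T) (gstar : R),
      is_max (fun y => exists p : C1per T, y = mu_lower T gamma p) gstar /\
      gstar = mu_lower T gamma pstar /\
      is_min (fun y => exists q : C1per0 T, y = mu_upper T gamma q) gstar /\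
      gstar = mu_upper T gamma pstar /\
      gstar <= 0 /\
      (gstar = 0 <-> forall t : R, hat T gamma t = 0)).
Proof.
assert (neg : forall p : C1per T, mu_lower T gamma p <= 0).
{ intros p. rewrite <- (upper_zero T gamma hT). now apply lower_le_upper. }
split; [intros p; now apply mu_lower_continuous|].
split; [intros q; now apply mu_upper_continuous|].
split; [intros p q; split; [now apply lower_le_upper|apply neg]|].
destruct (optimiser_exists T gamma hT) as [mu [p hp]].
destruct (riccati_optimal T mu gamma p hT hp) as [El Eu].
exists p, (- mu). split; [|split; [auto|split; [|split; [auto|split]]]].
- split; [now exists p|]. intros y [r ->]. rewrite <- Eu. now apply lower_le_upper.
- split; [now exists p|]. intros y [r ->]. rewrite <- El. now apply lower_le_upper.
- rewrite <- El. apply neg.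
- split.
  + intros E. apply (riccati_zero T (hat T gamma) p); auto.
    * intros t. apply hat_continuous, C1per_continuous.
    * intros t. unfold hat. now rewrite C1per_periodic.
    * apply hat_mean; auto. apply C1per_continuous.
    * intros t. replace (p t ^ 2 + hat T gamma t) with (Derive p t) by (rewrite hp; lra).
      apply Derive_correct, C1per_ex_derive.
    * apply C1per_periodic.
  + intros h0.
    (* The zero function solves the same Riccati equation, with [mu = 0]. *)
    apply Rle_antisym; [rewrite <- El; apply neg|].
    destruct (riccati_optimal T 0 gamma (C1per0_zero T) hT) as [E0 _].
    * intros t. simpl. rewrite Derive_const, h0. ring.
    * rewrite <- Eu. replace 0 with (mu_lower T gamma (C1per0_zero T)) by lra.
      now apply lower_le_upper.
Qed.
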